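(* Let $G_1, G_2$ be two directed graphs (possibly containing cycles) on the same vertex set $V=\{1,\dots,d\}$, underlying linear cyclic structural causal models $X = B_1X+\varepsilon^{(1)}$ and $X = B_2X+\varepsilon^{(2)}$ respectively, where $B_k\in\mathbb{R}^{d\times d}$ is the weighted adjacency matrix of $G_k$ and $\det(I-B_k)\neq 0$, so that the model is solved as $X=(I-B_k)^{-1}\varepsilon^{(k)}$. Assume that both models have no latent confounders (the noise vector has the same dimension $d$ as $X$), mutually independent noise terms, and at most one Gaussian noise component. If the two models induce the same observational distribution over $X$, then their condensations are equal, $G_1^{\mathrm{sc}} = G_2^{\mathrm{sc}}$; that is, $G_1$ and $G_2$ have the same partition of $V$ into strongly connected components and the same set of edges between strongly connected components in the condensation.
   Context: For $B\in\mathbb{R}^{d\times d}$ the associated directed graph $G=(V,E)$ has an edge $j\to i$ if and only if $B_{ij}\neq 0$. A strongly connected component (SCC) of $G$ is an equivalence class of the relation ''$u$ and $v$ are mutually reachable by directed paths'' (paths of length $0$ allowed). The condensation $G^{\mathrm{sc}}$ is the directed graph whose vertices are the SCCs of $G$, with an edge $\pi\to\pi'$ for $\pi\neq\pi'$ if and only if there are $u\in\pi$, $v\in\pi'$ with $(u,v)\in E$.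
   Formalization: The formal theorem additionally assumes that no noise term is almost surely constant and that no self-loop has weight exactly 1 (the diagonal entries of B_1 and B_2 differ from 1); without either assumption the claim fails for d = 2. *)

(* Defs.v *)
From HB Require Import structures.
From mathcomp Require Import all_boot all_order all_algebra.
From mathcomp Require Import all_classical all_reals all_analysis.

Set Implicit Arguments.
Unset Strict Implicit.
Unset Printing Implicit Defensive.

Import Order.TTheory GRing.Theory Num.Theory.
Import numFieldNormedType.Exports.

Local Open Scope ring_scope.

(* A directed graph on the finite vertex type V is its edge relation:
   [e u v] is the edge u -> v. *)
Section Condensation.
Context {V : finType}.
Implicit Type e : rel V.

Definition mutually_reachable e : rel V :=
  [rel u v | connect e u v && connect e v u].

Definition sccs e : {set {set V}} :=
  equivalence_partition (mutually_reachable e) (finset.setTfor V).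

Definition condensation_edges e : {set {set V} * {set V}} :=
  finset (fun p : {set V} * {set V} =>
    [&& p.1 \in sccs e, p.2 \in sccs e, p.1 != p.2
      & [exists u in p.1, exists v in p.2, e u v]]).

Definition condensation e := (sccs e, condensation_edges e).

End Condensation.

(* Mind the orientation: B i j is the weight of the edge j -> i. *)
Definition graph_of (R : realType) (d : nat) (B : 'M[R]_d) : rel 'I_d :=
  fun j i => B i j != 0.

Local Open Scope classical_set_scope.

Section RandomVariables.
Context {dO : measure_display} {Omega : measurableType dO} {R : realType}
  (P : probability Omega R).

Definition mutually_independent (I : finType) (X : I -> {RV P >-> R}) : Prop :=
  forall (J : {set I}) (A : I -> set R), (forall i, measurable (A i)) ->
    P (\bigcap_(i in [set` J]) (X i @^-1` A i)) =
    (\prod_(i in J) P (X i @^-1` A i))%E.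

(* The variance is required to be positive: normal_prob m 0 is a junk value. *)
Definition gaussian (X : {RV P >-> R}) : Prop :=
  exists m s : R, 0 < s /\
    forall A : set R, measurable A -> distribution P X A = normal_prob m s A.

(* An almost surely constant noise term carries no randomness, and leaves a
   column of (I - B)^-1 undetermined by the distribution of X up to a
   translation. *)
Definition nonconstant (X : {RV P >-> R}) : Prop :=
  forall c : R, ~ {ae P, forall w, X w = c}.

Definition col_of_tuple (d : nat) (x : d.-tuple R) : 'cV[R]_d :=
  \col_i tnth x i.

(* X is the vector of observed variables; R^d carries the product
   sigma-algebra of d.-tuple R. The noise is indexed by the same 'I_d
   as X, i.e. there are no latent confounders. *)
Record linear_scm (d : nat) (B : 'M[R]_d) (eps : 'I_d -> {RV P >-> R})
    (X : {RV P >-> d.-tuple R}) : Prop := LinearSCM {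
  scm_solvable : \det (1%:M - B) != 0 ;
  scm_equations : {ae P, forall w,
    col_of_tuple (X w) = B *m col_of_tuple (X w) + \col_i eps i w } ;
  scm_independent_noise : mutually_independent eps ;
  scm_one_gaussian : forall i j, gaussian (eps i) -> gaussian (eps j) -> i = j
}.

End RandomVariables.

Arguments mutually_independent {dO Omega R} P {I} X.
Arguments gaussian {dO Omega R} P X.
Arguments nonconstant {dO Omega R} P X.
Arguments linear_scm {dO Omega R} P {d} B eps X.

Definition same_distribution (R : realType) (d : nat)
    (d1 : measure_display) (O1 : measurableType d1) (P1 : probability O1 R)
    (X1 : {RV P1 >-> d.-tuple R})
    (d2 : measure_display) (O2 : measurableType d2) (P2 : probability O2 R)
    (X2 : {RV P2 >-> d.-tuple R}) : Prop :=
  forall A : set (d.-tuple R), measurable A ->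
    distribution P1 X1 A = distribution P2 X2 A.

Arguments same_distribution {R d d1 O1} P1 X1 {d2 O2} P2 X2.

(* Main.v *)
(* Idea. Writing the two models as (I - B_k) X = eps^(k), the matrix
   M = (I - B_2)(I - B_1)^-1 relates the characteristic functions of the noises:
   prod_j phi_j((tM)_j) = prod_i psi_i(t_i) for every row vector t. The right-hand
   side satisfies F(t) F(t + x e_i + y e_k) = F(t + x e_i) F(t + y e_k) for i <> k,
   and as M is invertible the arguments (tM)_j are free, so if column j of M has
   two nonzero entries M_ij, M_kj then, for small a and b and for every u,
   phi_j(u) phi_j(u+a+b) = phi_j(u+a) phi_j(u+b) K(a,b). This forces phi_j to be
   exp(i m t - s t^2), i.e. eps_j to be Gaussian; no appeal to the theorems of
   Marcinkiewicz or Cramer is needed. So at most one column j has two nonzero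
   entries; if there is one, some row of M is supported on column j, and then
   phi_j is multiplicative near 0, which contradicts s > 0. Hence M is monomial and
   I - B_2 is obtained from I - B_1 by permuting and rescaling its rows. Since both
   diagonals are nonzero, the permutation s satisfies i -> s(i) in G_1, so it moves
   every vertex inside its strongly connected component. *)
From HB Require Import structures.
Require Import Defs.
From mathcomp Require Import all_boot all_order all_algebra.
From mathcomp Require Import all_classical all_reals all_analysis.
From mathcomp Require Import measurable_realfun ring lra zify complex.

Set Implicit Arguments.
Unset Strict Implicit.
Unset Printing Implicit Defensive.

Import Order.TTheory GRing.Theory Num.Theory.
Import numFieldNormedType.Exports.
Local Open Scope ring_scope.
Local Open Scope classical_set_scope.
Local Open Scope complex_scope.

Local Notation Re := (@complex.Re _).
Local Notation Im := (@complex.Im _).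

(** * Functional equations for characteristic functions *)

Section FunctionalEquations.
Context {R : realType}.
Implicit Types (t u v a b : R) (z w : R[i]).

(** Every t is reached from 0 in finitely many equal steps shorter than e. This makes functional
    equations known only for small increments global. *)
Lemma small_steps (Q : R -> Prop) (e : R) : 0 < e ->
  Q 0 -> (forall u a, `|a| < e -> Q u -> Q (u + a)) -> forall t, Q t.
Proof.
move=> e0 Q0 Qstep t.
have [n tn] : exists n : nat, `|t| / n.+1%:R < e.
  exists (Num.truncn (`|t| / e)).
  rewrite ltr_pdivrMr// mulrC -ltr_pdivrMr//; exact: truncnS_gt.
have Qk k : Q (k%:R * (t / n.+1%:R)).
  elim: k => [|k IH]; first by rewrite mul0r.
  rewrite -natr1 mulrDl mul1r; apply: Qstep => //.
  by rewrite normrM normfV (ger0_norm (ler0n _ n.+1)).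
by have := Qk n.+1; rewrite mulrCA divff ?pnatr_eq0// mulr1.
Qed.

Lemma additive_continuous_linear (f : R -> R) :
  {morph f : a b / a + b} -> {for 0, continuous f} -> forall t, f t = t * f 1.
Proof.
move=> fD fc.
(* [D] is additive and 1-periodic, hence bounded, hence zero. *)
pose D t := f t - t * f 1.
have DD a b : D (a + b) = D a + D b by rewrite /D fD; ring.
have D0 : D 0 = 0 by have := DD 0 0; rewrite addr0; lra.
have D1 : D 1 = 0 by rewrite /D mul1r subrr.
have DMn n t : D (n%:R * t) = n%:R * D t.
  elim: n => [|n IH]; first by rewrite !mul0r D0.
  by rewrite -natr1 !mulrDl !mul1r DD IH.
have DN t : D (- t) = - D t by have := DD t (- t); rewrite subrr D0; lra.
have Dc : {for 0, continuous D}.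
  apply: cvgB; first exact: fc.
  by apply: cvgM; [exact: cvg_id | exact: cvg_cst].
have [e e0 De] : exists2 e : R, 0 < e & forall t, `|t| < e -> `|D t| < 1.
  move/cvgrPdist_lt : Dc => /(_ 1 ltr01)/nbhs_ballP[e /= e0 H].
  exists e => // t te; have := H t; rewrite /ball/= sub0r normrN => /(_ te).
  by rewrite D0 sub0r normrN.
(* As N exceeds 1/e, dividing a point of [0, 1) by N lands where [D] is below 1 in absolute value,
   so [D] is bounded by N on a full period. *)
pose N := (Num.truncn (e^-1)).+1.
have N0 : 0 < N%:R :> R by rewrite ltr0n.
have bnd t : 0 <= t < 1 -> `|D t| <= N%:R.
  move=> /andP[t0 t1]; have -> : t = N%:R * (t / N%:R).
    by rewrite mulrCA divff ?mulr1// gt_eqF.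
  rewrite DMn normrM ger0_norm// ler_piMr//; apply/ltW/De.
  rewrite ger0_norm ?divr_ge0// ltr_pdivrMr//.
  apply: (lt_trans t1); rewrite mulrC -ltr_pdivrMr// mul1r.
  exact: truncnS_gt.
have Dz (m : int) : D m%:~R = 0.
  by case: m => n; rewrite ?NegzE ?mulrNz ?DN -[_%:~R]mulr1 DMn D1 mulr0 ?oppr0.
have bndall t : `|D t| <= N%:R.
  rewrite -(subrK (Num.floor t)%:~R t) DD Dz addr0; apply: bnd.
  by have := floor_le t; have := floorD1_gt t; rewrite intrD; lra.
move=> t; apply/eqP; rewrite -subr_eq0 -/(D t); apply/negPn/negP => Dt.
(* A large enough integer multiple of t would push [D] above its bound. *)
have := bndall ((Num.truncn (N%:R / `|D t|)).+1%:R * t).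
rewrite DMn normrM (ger0_norm (ler0n _ _)) leNgt -ltr_pdivrMr ?normr_gt0//.
by rewrite truncnS_gt.
Qed.

Lemma realcM (x y : R) : (x * y)%:C = x%:C * y%:C.
Proof. exact: rmorphM. Qed.

Definition cis t : R[i] := cos t +i* sin t.

Lemma cisD a b : cis (a + b) = cis a * cis b.
Proof. by rewrite /cis cosD sinD; simpc; rewrite [X in _ +i* X]addrC. Qed.

Lemma cis0 : cis 0 = 1. Proof. by rewrite /cis cos0 sin0. Qed.

Definition sqrc z : R := Re z ^+ 2 + Im z ^+ 2.

Lemma sqrcM z w : sqrc (z * w) = sqrc z * sqrc w.
Proof. by case: z w => [a b] [c d]; rewrite /sqrc; simpc => /=; ring. Qed.

Lemma sqrc_cis t : sqrc (cis t) = 1.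
Proof. exact: cos2Dsin2. Qed.

Lemma mulc_conj z : z * conjc z = (sqrc z)%:C.
Proof. by case: z => a b; rewrite /sqrc; simpc; congr (_ +i* _) => /=; ring. Qed.

Lemma sqrc_eq0 z : (sqrc z == 0) = (z == 0).
Proof.
case: z => a b; rewrite /sqrc/= paddr_eq0 ?sqr_ge0// !sqrf_eq0.
by rewrite [RHS]eq_complex.
Qed.

Lemma sqrc_real (x : R) : sqrc x%:C = x ^+ 2.
Proof. by rewrite /sqrc/= expr0n addr0. Qed.

(* Doubling t at least doubles 1 - Re (h t) while Re (h t) stays positive. *)
Lemma circle_character_positive (h : R -> R[i]) :
  {morph h : a b / a + b >-> a * b} -> (forall t, sqrc (h t) = 1) ->
  (forall t, 0 < Re (h t)) -> forall t, h t = 1.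
Proof.
move=> hM h1 hp t.
have dbl v : Re (h (v + v)) = 2 * Re (h v) ^+ 2 - 1.
  by rewrite hM; have := h1 v; case: (h v) => a b; rewrite /sqrc/=; nra.
have le1 v : Re (h v) <= 1.
  by have := h1 v; rewrite /sqrc; have := sqr_ge0 (Im (h v)); nra.
have grow n : (2 ^ n)%:R * (1 - Re (h t)) <= 1 - Re (h ((2 ^ n)%:R * t)).
  elim: n => [|n IH]; first by rewrite expn0 !mul1r.
  rewrite expnS mul2n -addnn natrD !mulrDl dbl.
  by move: IH (hp ((2 ^ n)%:R * t)) (le1 ((2 ^ n)%:R * t)); nra.
have Re1 : Re (h t) = 1.
  apply/eqP/negPn/negP => n1.
  have lt1 : 0 < 1 - Re (h t) by rewrite subr_gt0 lt_neqAle n1 le1.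
  pose k := (Num.truncn ((1 - Re (h t))^-1)).+1.
  have : 1 < (2 ^ k)%:R * (1 - Re (h t)).
    rewrite -ltr_pdivrMr// mul1r; apply: (lt_trans (truncnS_gt _)).
    by rewrite ltr_nat ltn_expl.
  by have := grow k; have := hp ((2 ^ k)%:R * t); lra.
move: (h1 t) Re1; case: (h t) => a b /=; rewrite /sqrc/= => + a1.
rewrite a1 expr1n => h0; have /eqP : b ^+ 2 = 0 by lra.
by rewrite sqrf_eq0 => /eqP ->.
Qed.

(** Choose m so that [cis (m * e)] equals [h e] for a small e. The quotient [w] of the two
    characters then has period e and positive real part on [0, e], hence everywhere, so it is
    trivial. *)
Lemma circle_character (h : R -> R[i]) :
  {morph h : a b / a + b >-> a * b} -> (forall t, sqrc (h t) = 1) ->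
  {for 0, continuous (fun t => Re (h t))} ->
  exists m, forall t, h t = cis (m * t).
Proof.
move=> hM h1 hc.
have h0 : h 0 = 1.
  have hn0 : h 0 != 0 by rewrite -sqrc_eq0 h1 oner_neq0.
  by apply: (mulfI hn0); rewrite -hM addr0 mulr1.
(* Two points of the unit circle with real parts above 3/4 have real parts with product above 9/16
   and imaginary parts with product below 7/16 in absolute value; this makes [Re (w t)] positive
   below. *)
have [e e0 he] : exists2 e : R, 0 < e & forall t, `|t| <= e -> 3 / 4 < Re (h t).
  have p4 : 0 < 1 / 4 :> R by lra.
  move/cvgrPdist_lt : hc => /(_ _ p4)/nbhs_ballP[e /= e0 H].
  exists (e / 2); first by lra.
  move=> t te; have := H t; rewrite /ball/= sub0r normrN.
  have tle : `|t| < e by lra.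
  by move=> /(_ tle); rewrite h0/= ltr_norml; lra.
have hee : 3 / 4 < Re (h e) by apply: he; rewrite gtr0_norm.
have imb : -1 <= Im (h e) <= 1.
  by have := h1 e; rewrite /sqrc; move: hee; nra.
pose th := asin (Im (h e)).
have sth : sin th = Im (h e) by rewrite asinK// in_itv.
have cth : cos th = Re (h e).
  rewrite cos_asin//; have := h1 e; rewrite /sqrc => <-.
  by rewrite addrK sqrtr_sqr ger0_norm//; lra.
have thb : `|th| <= pi.
  rewrite ler_norml; have := asin_geNpi2 imb; have := asin_lepi2 imb.
  by have := @pi_gt0 R; rewrite -/th; lra.
pose m := th / e.
pose w t := h t * cis (- (m * t)).
have wM : {morph w : a b / a + b >-> a * b}.
  by move=> a b; rewrite /w hM mulrDr opprD cisD; ring.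
have w1 t : sqrc (w t) = 1 by rewrite sqrcM h1 sqrc_cis mulr1.
have we : w e = 1.
  have -> : w e = cis th * cis (- th).
    rewrite /w /m divfK ?gt_eqF//; congr (_ * _); rewrite /cis cth sth.
    by case: (h e).
  by rewrite -cisD subrr cis0.
have w0 : w 0 = 1 by rewrite /w h0 mulr0 oppr0 cis0 mulr1.
have wn (n : nat) : w (n%:R * e) = 1.
  elim: n => [|n IH]; first by rewrite mul0r.
  by rewrite -natr1 mulrDl mul1r wM IH we mulr1.
have wz (n : int) : w (n%:~R * e) = 1.
  case: n => n; first exact: wn.
  have := wM (n.+1%:R * e) (- (n.+1%:R * e)).
  by rewrite subrr w0 wn mul1r NegzE mulrNz mulNr => <-.
have wloc t : 0 <= t <= e -> 0 < Re (w t).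
  move=> /andP[t0 te].
  have ht : 3 / 4 < Re (h t) by apply: he; rewrite ger0_norm.
  have cm : 3 / 4 < cos (m * t).
    apply: (lt_le_trans hee); rewrite -cth -(cos_norm th) -(cos_norm (m * t)).
    have mt : `|m * t| <= `|th|.
      rewrite /m -mulrA normrM ler_piMr// normrM normfV.
      rewrite !ger0_norm ?(ltW e0)// mulrC ler_pdivrMr// mul1r//.
    rewrite leNgt ltr_cos ?in_itv/= ?normr_ge0 ?thb ?(le_trans mt thb)//.
    by rewrite -leNgt.
  have -> : Re (w t) = Re (h t) * cos (m * t) + Im (h t) * sin (m * t).
    by rewrite /w /cis cosN sinN; case: (h t) => a b /=; ring.
  have := h1 t; rewrite /sqrc; have := cos2Dsin2 (m * t).
  have := sqr_ge0 (Im (h t) + sin (m * t)).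
  by move: ht cm; nra.
have wp t : 0 < Re (w t).
  rewrite -(subrK ((Num.floor (t / e))%:~R * e) t) wM wz mulr1; apply: wloc.
  have fl := floor_le (t / e); have := floorD1_gt (t / e).
  rewrite intrD ltr_pdivrMr// => fg.
  move: fl; rewrite ler_pdivlMr//; move: fg.
  by lra.
exists m => t.
have := circle_character_positive wM w1 wp t;
  rewrite /w => /(congr1 (fun z => z * cis (m * t))).
by rewrite -mulrA -cisD addNr cis0 mulr1 mul1r.
Qed.

Lemma quadratic_functional_equation (f : R -> R[i]) (e : R) : 0 < e ->
    f 0 = 1 -> (forall t, f (- t) = conjc (f t)) ->
    continuous (fun t => Re (f t)) -> continuous (fun t => Im (f t)) ->
    (forall a b, `|a| < e -> `|b| < e ->
       exists2 K, K != 0 & forall u, f u * f (u + a + b) = f (u + a) * f (u + b) * K) ->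
  exists m s, forall t, f t = (expR (- (s * t ^+ 2)))%:C * cis (m * t).
Proof.
move=> e0 f0 fN fRc fIc fK.
have fn0 t : f t != 0.
  move: t; apply: (small_steps e0); first by rewrite f0 oner_neq0.
  move=> u a ae fu; have Nae : `|- a| < e by rewrite normrN.
  (* Based at u + a with both increments - a, the equation reads f (u + a) * f (u - a) = f u ^ 2 *
     K, so a zero at u + a would force one at u. *)
  have [K K0 /(_ (u + a))] := fK _ _ Nae Nae.
  rewrite addrK; move/eqP; apply: contraTneq => ->.
  by rewrite mul0r eq_sym !mulf_neq0.
(* [B] is bimultiplicative with B a a = |f a|^2, and B a b = (B (a/2) b)^2 is
   then a positive real, so B a b = exp (k a b); dividing f by exp (k t^2 / 2)
   leaves a character of the circle. *)
pose B a b := f (a + b) / (f a * f b).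
have BC a b : B a b = B b a by rewrite /B addrC [f a * _]mulrC.
have B0 a : B 0 a = 1 by rewrite /B add0r f0 mul1r divff.
(* The cocycle identity of the coboundary [B]; it extends multiplicativity in the first argument
   from small second arguments to all of them. *)
have coc a b c : B a b * B (a + b) c = B a (b + c) * B b c.
  by rewrite /B addrA; field; rewrite !fn0.
have Bsmall a : `|a| < e -> forall u b, B (u + b) a = B u a * B b a.
  move=> ae u b; move: b u; apply: (small_steps e0) => [u|b c ce IH u].
    by rewrite addr0 B0 mulr1.
  have st v : B (v + c) a = B v a * B c a.
    have [K K0 HK] := fK _ _ ce ae.
    have KB : K = B c a.
      have := HK 0; rewrite f0 mul1r !add0r /B => ->.
      by field; rewrite !fn0.
    have := HK v; rewrite KB /B => HKv.
    have -> : f (v + c + a) = f (v + c) * f (v + a) * (f (c + a) / (f c * f a)) / f v.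
      by rewrite -HKv [f v * _]mulrC mulfK.
    by field; rewrite !fn0.
  by rewrite addrA (st (u + b)) IH -mulrA (st b).
have BD a : forall u b, B (u + b) a = B u a * B b a.
  move: a; apply: (small_steps e0) => [u b|a c ce IH u b].
    by rewrite ![B _ 0]BC !B0 mulr1.
  have BDa v : B v (a + c) = B v a * B v c.
    apply: (mulIf (_ : B a c != 0)); first by rewrite /B mulf_neq0 ?invr_neq0 ?mulf_neq0.
    by rewrite -coc (Bsmall c ce); ring.
  by rewrite !BDa IH Bsmall//; ring.
pose g t := sqrc (f t).
have gp t : 0 < g t.
  by rewrite lt_neqAle eq_sym sqrc_eq0 fn0/= addr_ge0 ?sqr_ge0.
have Bn0 a b : B a b != 0 by rewrite /B mulf_neq0 ?invr_neq0 ?mulf_neq0.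
(* Bimultiplicativity gives B (-a) a * B a a = 1, and B (-a) a = 1 / |f a|^2 because f (-a) is the
   conjugate of f a. *)
have Bg a : B a a = (g a)%:C.
  have := BD (- a) a (a); have := BD a a (- a); rewrite subrr B0 => /esym h1 _.
  apply: (mulIf (Bn0 (- a) a)); rewrite h1 /B addNr f0 fN div1r.
  by rewrite [conjc _ * _]mulrC mulc_conj divff// fmorph_eq0 gt_eqF.
(* Polarisation: expanding B z z at z = x/2 + y gives g (x/2) * B (x/2) y ^ 2 * g y, so [b x y] is B
   (x/2) y ^ 2 = B x y written through the positive function [g]. *)
pose b x y := g (x / 2 + y) / (g (x / 2) * g y).
have bp x y : 0 < b x y by rewrite divr_gt0 ?mulr_gt0.
have Bb x y : B x y = (b x y)%:C.
  have -> : B x y = B (x / 2) y * B (x / 2) y by rewrite -BD; congr B; lra.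
  rewrite /b rmorphM fmorphV rmorphM /= -!Bg BD.
  rewrite ![B _ (_ + y)]BC !BD [B y (x / 2)]BC.
  by field; rewrite !Bn0.
have bD c x y : b (x + y) c = b x c * b y c.
  by have := BD c x y; rewrite !Bb -realcM => /(@complexI R).
have bC x y : b x y = b y x by have := BC x y; rewrite !Bb => /(@complexI R).
have gc : continuous g.
  move=> t; rewrite /g /sqrc; apply: cvgD; rewrite expr2.
    by apply: cvgM; exact: fRc.
  by apply: cvgM; exact: fIc.
have lnb x : forall t, ln (b t x) = t * ln (b 1 x).
  apply: (@additive_continuous_linear (fun t => ln (b t x))) => [u v|].
    by rewrite bD lnM ?posrE.
  apply: (@continuous_comp _ _ _ (fun t => b t x) (@ln R)); last exact: continuous_ln.
  have hc : {for 0, continuous (fun t : R => t / 2)}.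
    by apply: cvgM; [exact: cvg_id | exact: cvg_cst].
  apply: cvgM.
    apply: (@continuous_comp _ _ _ (fun t : R => t / 2 + x) g); last exact: gc.
    by apply: cvgD; [exact: hc | exact: cvg_cst].
  apply: cvgV; first by rewrite gt_eqF// mulr_gt0.
  apply: cvgM; last exact: cvg_cst.
  by apply: (@continuous_comp _ _ _ (fun t : R => t / 2) g); [exact: hc | exact: gc].
pose k := ln (b 1 1).
have bE x y : b x y = expR (k * x * y).
  rewrite -[LHS]lnK ?posrE//; congr expR.
  by rewrite lnb bC lnb -/k; ring.
have gE t : g t = expR (k * t ^+ 2).
  by have := Bg t; rewrite Bb bE expr2 mulrA => /(@complexI R).
pose h t := f t * (expR (- (k / 2) * t ^+ 2))%:C.
have hM : {morph h : x y / x + y >-> x * y}.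
  move=> x y; rewrite /h.
  have -> : f (x + y) = f x * f y * (expR (k * x * y))%:C.
    by rewrite -bE -Bb /B mulrC divfK// mulf_neq0.
  have -> : - (k / 2) * (x + y) ^+ 2 =
    - (k * x * y) + (- (k / 2) * x ^+ 2) + (- (k / 2) * y ^+ 2).
    by field.
  rewrite !expRD expRN !realcM fmorphV/=; field.
  by rewrite !fmorph_eq0 !gt_eqF ?expR_gt0.
have h1 t : sqrc (h t) = 1.
  rewrite sqrcM -/(g t) gE sqrc_real [X in _ * X]expr2 -!expRD.
  by rewrite (_ : _ + _ = 0) ?expR0//; field.
have hc : {for 0, continuous (fun t => Re (h t))}.
  have -> : (fun t => Re (h t)) = (fun t => Re (f t) * expR (- (k / 2) * t ^+ 2)).
    by apply/funext => t; rewrite /h; case: (f t) => x y /=; rewrite mulr0 subr0.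
  apply: cvgM; first exact: fRc.
  apply: (@continuous_comp _ _ _ (fun t : R => - (k / 2) * t ^+ 2) (@expR R));
    last exact: continuous_expR.
  by apply: cvgM; [exact: cvg_cst | exact: exprn_continuous].
have [m hE] := circle_character hM h1 hc.
exists m, (- (k / 2)) => t; rewrite -hE /h mulrCA -realcM -expRD.
by rewrite addNr expR0 mulr1.
Qed.

End FunctionalEquations.

(** * Bounded measurable functions *)

Section BoundedMeasurable.
Context d (T : measurableType d) (R : realType).

Definition bmeas (f : T -> R) :=
  measurable_fun setT f /\ exists M, forall x, `|f x| <= M.

Lemma bmeas_cst c : bmeas (fun=> c).
Proof. by split; [exact: measurable_cst | exists `|c|]. Qed.

Lemma bmeasD f g : bmeas f -> bmeas g -> bmeas (fun x => f x + g x).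
Proof.
move=> [mf [M fM]] [mg [N gN]]; split; first exact: measurable_funD.
by exists (M + N) => x; rewrite (le_trans (ler_normD _ _))// lerD.
Qed.

Lemma bmeasM f g : bmeas f -> bmeas g -> bmeas (fun x => f x * g x).
Proof.
move=> [mf [M fM]] [mg [N gN]]; split; first exact: measurable_funM.
by exists (M * N) => x; rewrite normrM ler_pM.
Qed.

Lemma bmeasB f g : bmeas f -> bmeas g -> bmeas (fun x => f x - g x).
Proof.
move=> [mf [M fM]] [mg [N gN]]; split; first exact: measurable_funB.
by exists (M + N) => x; rewrite (le_trans (ler_normB _ _))// lerD.
Qed.

Lemma bmeas_cos f : measurable_fun setT f -> bmeas (fun x => cos (f x)).
Proof.
move=> mf; split; last by exists 1 => x; exact: cos_max.
apply: measurableT_comp mf; apply: continuous_measurable_fun.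
exact: continuous_cos.
Qed.

Lemma bmeas_sin f : measurable_fun setT f -> bmeas (fun x => sin (f x)).
Proof.
move=> mf; split; last by exists 1 => x; exact: sin_max.
apply: measurableT_comp mf; apply: continuous_measurable_fun.
exact: continuous_sin.
Qed.

Variable P : probability T R.

Lemma bmeas_integrable f : bmeas f -> P.-integrable setT (EFin \o f).
Proof.
move=> [mf [M fM]]; apply: measurable_bounded_integrable => //.
  by apply: le_lt_trans (probability_le1 P _) (ltry _).
exists M; split; first exact: num_real.
by move=> N MN x _; exact: le_trans (fM x) (ltW MN).
Qed.

Lemma bounded_cvg_Rintegral (f_ : (T -> R)^nat) f M :
  (forall n, measurable_fun setT (f_ n)) -> (forall n x, `|f_ n x| <= M) ->
  (forall x, f_ ^~ x @ \oo --> f x) ->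
  (\int[P]_x f_ n x)%R @[n --> \oo] --> (\int[P]_x f x)%R.
Proof.
move=> mf fM ff.
have mlim : measurable_fun setT f.
  by apply: (measurable_fun_cvg mf) => x _; exact: ff.
have fbM x : `|f x| <= M.
  have : (fun n => `|f_ n x|) @ \oo --> `|f x| by apply: cvg_norm; exact: ff.
  by move/cvgr_to_le; apply; exact: nearW.
have bf : bmeas f by split => //; exists M.
apply: fine_cvg; rewrite /Rintegral fineK; last first.
  by apply: integrable_fin_num => //; exact: bmeas_integrable.
apply: (@dominated_cvg _ _ _ P setT _ (fun n x => (f_ n x)%:E) _ (fun=> M%:E)) => //.
- by move=> n; apply/measurable_EFinP.
- by move=> x _; apply: cvg_EFin; [exact: nearW | exact: ff].
- exact: (bmeas_integrable (bmeas_cst M)).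
- by move=> n x _; rewrite lee_fin.
Qed.

End BoundedMeasurable.

(** * Polynomials converging pointwise to the indicator of a half-line on [0, 1] *)

Section IndicatorApproximation.
Context (R : realType).
Implicit Types (p c q y : R).

Lemma bernoulli_ineq p n : 0 <= 1 + p -> 1 + n%:R * p <= (1 + p) ^+ n.
Proof.
move=> p1; elim: n => [|n IH]; first by rewrite mul0r addr0 expr0.
rewrite exprS -natr1; apply: le_trans (ler_wpM2l p1 IH).
by have := mulr_ge0 (ler0n R n) (sqr_ge0 p); nra.
Qed.

(** Split q as s ^ 2: Bernoulli's inequality for 1/s bounds n * s ^ n, and the remaining factor s ^
    n tends to 0. *)
Lemma cvg_nat_expr q : 0 <= q < 1 -> (fun n => n%:R * q ^+ n) @ \oo --> (0 : R).
Proof.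
move=> /andP[q0 q1].
have [->|qn0] := eqVneq q 0.
  apply: (@cvg_trans _ (nbhs (0 : R))); last by [].
  apply: cvg_near_cst; exists 1%N => // n /= n1.
  by rewrite expr0n; case: n n1 => //= n _; rewrite mulr0.
have q0' : 0 < q by rewrite lt_neqAle eq_sym qn0.
pose s := Num.sqrt q.
have s0 : 0 < s by rewrite sqrtr_gt0.
have ss : s ^+ 2 = q by rewrite sqr_sqrtr.
have s1 : s < 1 by rewrite -(@ltr_pXn2r _ 2) ?nnegrE ?ltW// ss expr1n.
pose C := (s^-1 - 1)^-1.
have si : 0 < s^-1 - 1 by rewrite subr_gt0 invf_gt1.
have bnd n : n%:R * s ^+ n <= C.
  have h0 : 0 <= 1 + (s^-1 - 1) by rewrite addrC subrK invr_ge0 ltW.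
  have := bernoulli_ineq n h0; rewrite [1 + (_ - 1)]addrC subrK exprVn => B.
  rewrite /C -[leRHS]div1r ler_pdivlMr// mulrAC -ler_pdivlMr ?exprn_gt0// div1r.
  by lra.
apply: (@squeeze_cvgr _ _ _ _ (fun=> 0) (fun n => C * s ^+ n)).
- apply: nearW => n; rewrite mulr_ge0 ?exprn_ge0//=.
  have -> : q ^+ n = s ^+ n * s ^+ n by rewrite -ss exprAC expr2.
  by rewrite mulrA ler_wpM2r ?exprn_ge0// ltW.
- exact: cvg_cst.
- by rewrite -(mulr0 C); apply: cvgMr; apply: cvg_expr; rewrite ger0_norm ?(ltW s0).
Qed.

Definition threshold_exponent c n := (Num.truncn (n%:R / c ^+ n)).+1.

(* The Brosowski-Deutsch polynomials: the exponent is about n c^-n, so that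
   it beats y^n exactly when c <= y. *)
Definition threshold_poly c n y := 1 - (1 - y ^+ n) ^+ threshold_exponent c n.

Lemma threshold_poly_bounded c n y : 0 <= y <= 1 -> 0 <= threshold_poly c n y <= 1.
Proof.
move=> /andP[y0 y1]; have yn0 := exprn_ge0 n y0.
have yn1 : y ^+ n <= 1 by rewrite exprn_ile1.
rewrite /threshold_poly subr_ge0 exprn_ile1 ?subr_ge0//=; last by rewrite lerBlDr lerDl.
by rewrite lerBlDr lerDl exprn_ge0// subr_ge0.
Qed.

(** Let p = y ^ n and let k be the exponent. If c <= y then k * p >= n, and (1 - p) ^ k * (1 + p) ^
    k <= 1 with Bernoulli bounds (1 - p) ^ k by 1 / (n + 1). If y < c, Bernoulli bounds the
    polynomial by k * p <= n * (y / c) ^ n + y ^ n. *)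
Lemma cvg_threshold_poly c y : 0 < c <= 1 -> 0 <= y <= 1 ->
  (fun n => threshold_poly c n y) @ \oo --> ((c <= y)%R%:R : R).
Proof.
move=> /andP[c0 c1] /andP[y0 y1].
have yn0 n := exprn_ge0 n y0.
have yn1 n : y ^+ n <= 1 by rewrite exprn_ile1.
have cn0 n := exprn_gt0 n c0.
have [cy|yc] := leP c y.
  apply: (@squeeze_cvgr _ _ _ _ (fun n => 1 - harmonic n) (fun=> 1)); last 2 first.
  - by rewrite -[X in _ --> X]subr0; apply: cvgB; [exact: cvg_cst | exact: cvg_harmonic].
  - exact: cvg_cst.
  apply: nearW => n; have /andP[_ ->]
    := threshold_poly_bounded c n (introT andP (conj y0 y1)).
  rewrite andbT lerD2l lerN2 /harmonic/=.
  set p := y ^+ n; set k := threshold_exponent c n.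
  have p0 : 0 <= p := yn0 n.
  have p1 : p <= 1 := yn1 n.
  have np : n%:R <= k%:R * p.
    have h1 : n%:R / c ^+ n < k%:R := truncnS_gt _.
    have h2 : c ^+ n <= p by apply: lerXn2r => //; rewrite nnegrE ltW.
    rewrite ltr_pdivrMr// in h1; apply: (le_trans (ltW h1)).
    by rewrite ler_wpM2l.
  have B : 1 + k%:R * p <= (1 + p) ^+ k by apply: bernoulli_ineq; lra.
  have q0 : 0 <= (1 - p) ^+ k by rewrite exprn_ge0 // subr_ge0.
  have : (1 - p) ^+ k * (1 + p) ^+ k <= 1.
    rewrite -exprMn exprn_ile1//; first by nra.
    by nra.
  rewrite -[_^-1]div1r ler_pdivlMr ?ltr0n// -natr1.
  have := ler_wpM2l q0 B; have := ler_wpM2l q0 np; move: q0.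
  by set Z := (1 - p) ^+ k; set W := (1 + p) ^+ k; nra.
have yc1 : 0 <= y / c < 1.
  by rewrite divr_ge0 ?(ltW c0)//= ltr_pdivrMr// mul1r.
have ylt1 : `|y| < 1 by rewrite ger0_norm//; lra.
apply: (@squeeze_cvgr _ _ _ _ (fun=> 0) (fun n => (n%:R * (y / c) ^+ n) + y ^+ n)).
- apply: nearW => n; have /andP[-> _]/=
  := threshold_poly_bounded c n (introT andP (conj y0 y1)).
  rewrite /threshold_poly; set p := y ^+ n; set k := threshold_exponent c n.
  have B : 1 + k%:R * - p <= (1 + - p) ^+ k.
    by apply: bernoulli_ineq; rewrite subr_ge0; exact: yn1.
  have kn : k%:R <= n%:R / c ^+ n + 1.
    rewrite /k /threshold_exponent -natr1 lerD2r truncn_le//.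
    by rewrite divr_ge0 ?ler0n// ltW.
  have := ler_wpM2r (yn0 n) kn; rewrite -/p exprMn exprVn -/p.
  by move: B; set Z := (1 + - p) ^+ k; set W := (c ^+ n)^-1; lra.
- exact: cvg_cst.
- by rewrite -[X in _ --> X]addr0; apply: cvgD; [exact: cvg_nat_expr | exact: cvg_expr].
Qed.

End IndicatorApproximation.

(** * Uniqueness of characteristic functions *)

Section Uniqueness.
Context {R : realType}.
Implicit Types (a b c r t x : R) (f g : R -> R).

(** The phase c makes sines and constants instances of the one generator, so closure under products
    needs a single product-to-sum formula. *)
Inductive trig_poly : (R -> R) -> Prop :=
| trig_cos t c : trig_poly (fun x => cos (t * x + c))
| trig_scale k f : trig_poly f -> trig_poly (fun x => k * f x)
| trig_add f g : trig_poly f -> trig_poly g -> trig_poly (fun x => f x + g x).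

Lemma trig_cst k : trig_poly (fun=> k).
Proof.
have -> : (fun=> k) = (fun x => k * cos (0 * x + 0)) :> (R -> R).
  by apply/funext => x; rewrite mul0r addr0 cos0 mulr1.
exact/trig_scale/trig_cos.
Qed.

Lemma trig_mul f g : trig_poly f -> trig_poly g -> trig_poly (fun x => f x * g x).
Proof.
move=> tf tg; elim: tf => {f} [t c|k f _ IH|f1 f2 _ IH1 _ IH2].
- elim: tg => {g} [t' c'|k g _ IH|g1 g2 _ IH1 _ IH2].
  + have -> : (fun x => cos (t * x + c) * cos (t' * x + c')) =
      (fun x => 2^-1 * (cos ((t + t') * x + (c + c')) + cos ((t - t') * x + (c - c')))).
      apply/funext => x.
      have -> : (t + t') * x + (c + c') = (t * x + c) + (t' * x + c') by ring.
      have -> : (t - t') * x + (c - c') = (t * x + c) - (t' * x + c') by ring.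
      move: (t * x + c) (t' * x + c') => u v.
      by rewrite cosD cosB; field.
    by apply/trig_scale/trig_add; exact: trig_cos.
  + have -> : (fun x => cos (t * x + c) * (k * g x)) =
      (fun x => k * (cos (t * x + c) * g x)) by apply/funext => x; ring.
    exact: trig_scale.
  + have -> : (fun x => cos (t * x + c) * (g1 x + g2 x)) =
      (fun x => cos (t * x + c) * g1 x + cos (t * x + c) * g2 x) by apply/funext => x; ring.
    exact: trig_add.
- have -> : (fun x => k * f x * g x) = (fun x => k * (f x * g x)) by apply/funext => x;
  ring.
  exact: trig_scale.
- have -> : (fun x => (f1 x + f2 x) * g x) = (fun x => f1 x * g x + f2 x * g x).
    by apply/funext => x; ring.
  exact: trig_add.
Qed.

Lemma trig_exp f n : trig_poly f -> trig_poly (fun x => f x ^+ n).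
Proof.
move=> tf; elim: n => [|n IH].
  by under eq_fun do rewrite expr0; exact: trig_cst.
by under eq_fun do rewrite exprS; exact: trig_mul.
Qed.

Lemma trig_onem f : trig_poly f -> trig_poly (fun x => 1 - f x).
Proof.
move=> tf; have -> : (fun x => 1 - f x) = (fun x => 1 + (-1) * f x).
  by apply/funext => x; rewrite mulN1r.
by apply: trig_add; [exact: trig_cst | exact: trig_scale].
Qed.

Lemma trig_bmeas f : trig_poly f -> bmeas (f : measurableTypeR R -> R).
Proof.
elim=> {f} [t c|k f _ IH|f1 f2 _ IH1 _ IH2].
- apply: bmeas_cos; apply: measurable_funD; last exact: measurable_cst.
  by apply: measurable_funM => //; exact: measurable_cst.
- by apply: bmeasM => //; exact: bmeas_cst.
- exact: bmeasD.
Qed.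

Variables mu nu : probability (measurableTypeR R) R.
Hypothesis cosE : forall t, \int[mu]_x cos (t * x) = \int[nu]_x cos (t * x).
Hypothesis sinE : forall t, \int[mu]_x sin (t * x) = \int[nu]_x sin (t * x).

(** The uniform bound belongs to the class so that bounded convergence closes it under pointwise
    limits. *)
Definition same_integral f := [/\ measurable_fun setT (f : measurableTypeR R -> R),
  (forall x, 0 <= f x <= 1) & \int[mu]_x f x = \int[nu]_x f x].

Lemma trig_same f : trig_poly f -> \int[mu]_x f x = \int[nu]_x f x.
Proof.
elim=> {f} [t c|k f tf IH|f1 f2 tf1 IH1 tf2 IH2].
- have mt : measurable_fun setT (fun x : measurableTypeR R => t * x).
    by apply: measurable_funM => //; exact: measurable_cst.
  have E (P : probability (measurableTypeR R) R) : \int[P]_x cos (t * x + c) =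
     cos c * \int[P]_x cos (t * x) + (- sin c) * \int[P]_x sin (t * x).
    rewrite -!RintegralZl//; try exact/bmeas_integrable/bmeas_cos;
      try exact/bmeas_integrable/bmeas_sin.
    rewrite -RintegralD//; last 2 first.
    - by apply/bmeas_integrable/bmeasM; [exact: bmeas_cst | exact: bmeas_cos].
    - by apply/bmeas_integrable/bmeasM; [exact: bmeas_cst | exact: bmeas_sin].
    by apply: eq_Rintegral => x _; rewrite cosD; ring.
  by rewrite !E cosE sinE.
- by rewrite !RintegralZl ?IH//; exact/bmeas_integrable/trig_bmeas.
- by rewrite !RintegralD ?IH1 ?IH2//; exact/bmeas_integrable/trig_bmeas.
Qed.

Lemma same_cvg (f_ : (R -> R)^nat) f : (forall n, same_integral (f_ n)) ->
  (forall x, f_ ^~ x @ \oo --> f x) -> same_integral f.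
Proof.
move=> sf ff.
have mf_ n : measurable_fun setT (f_ n : measurableTypeR R -> R) by case: (sf n).
have f01 n x : 0 <= f_ n x <= 1 by case: (sf n).
have fb n x : `|f_ n x| <= 1.
  by have := f01 n x; rewrite ler_norml; lra.
split.
- by apply: (measurable_fun_cvg mf_) => x _; exact: ff.
- move=> x; apply/andP; split.
    by apply: (cvgr_to_ge (ff x)); apply: nearW => n; case/andP: (f01 n x).
  by apply: (cvgr_to_le (ff x)); apply: nearW => n; case/andP: (f01 n x).
- have h1 := bounded_cvg_Rintegral (P := mu) mf_ fb ff.
  have h2 := bounded_cvg_Rintegral (P := nu) mf_ fb ff.
  apply: (@cvg_unique _ _ _ _ _ _ h1); first exact: norm_hausdorff.
  rewrite (_ : (fun n => _) = (fun n => \int[nu]_x f_ n x)) //.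
  by apply/funext => n; case: (sf n).
Qed.

(* These are indicators of periodic unions of intervals; as the period grows, only
   the interval around [a] remains. *)
Lemma same_periodic a (m : nat) c : 0 < c <= 1 ->
  same_integral (fun x => (c <= (1 + cos ((x - a) / m.+1%:R)) / 2)%R%:R).
Proof.
move=> c01; pose y x := (1 + cos ((x - a) / m.+1%:R)) / 2.
have y01 x : 0 <= y x <= 1.
  by rewrite /y; have := cos_geN1 ((x - a) / m.+1%:R);
    have := cos_le1 ((x - a) / m.+1%:R); lra.
apply: (@same_cvg (fun n x => threshold_poly c n (y x))); last first.
  by move=> x; exact: cvg_threshold_poly.
have ty : trig_poly y.
  have -> : y = fun x => 2^-1 * (1 + cos (m.+1%:R^-1 * x + - a / m.+1%:R)).
    by apply/funext => x; rewrite /y mulrC mulrBl [x / _]mulrC mulNr.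
  by apply/trig_scale/trig_add; [exact: trig_cst | exact: trig_cos].
move=> n.
have tt : trig_poly (fun x => threshold_poly c n (y x)).
  by apply/trig_onem/trig_exp/trig_onem/trig_exp.
split; [by have [] := trig_bmeas tt | | exact: trig_same].
by move=> x; exact: threshold_poly_bounded.
Qed.

Lemma same_itvcc a b : a <= b -> same_integral (\1_(`[a, b])).
Proof.
move=> ab; pose z := (a + b) / 2; pose r := (b - a) / 2.
have r0 : 0 <= r by rewrite /r; lra.
(* With [m0] added to the index, r divided by the scale stays below pi, where cosine is strictly
   decreasing; [c m] is the value taken by the rescaled cosine at both ends of the interval. *)
pose m0 := Num.truncn (r / pi).
have pi0 := @pi_gt0 R.
have rm m : r / (m + m0).+1%:R < pi.
  rewrite ltr_pdivrMr// mulrC -ltr_pdivrMr//.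
  by apply: lt_le_trans (truncnS_gt _) _; rewrite ler_nat ltnS leq_addl.
have rm0 m : 0 <= r / (m + m0).+1%:R by rewrite divr_ge0.
pose c m := (1 + cos (r / (m + m0).+1%:R)) / 2.
have c01 m : 0 < c m <= 1.
  have : cos pi < cos (r / (m + m0).+1%:R).
    by rewrite ltr_cos ?in_itv/= ?lexx ?rm0 ?(ltW (rm m)) ?pi_ge0 ?rm.
  by rewrite cospi /c; have := cos_le1 (r / (m + m0).+1%:R); lra.
apply: (@same_cvg (fun m x => (c m <= (1 + cos ((x - z) / (m + m0).+1%:R)) / 2)%R%:R)).
  by move=> m; exact: same_periodic.
move=> x; apply: cvg_near_cst.
(* From this index on, x lies in the central period, where comparing cosines amounts to comparing |x
   - z| with r. *)
exists (Num.truncn (`|x - z| / pi)) => // m /= xm.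
set N := (m + m0).+1%:R : R.
have N0 : 0 < N by rewrite ltr0n.
have xN : `|x - z| / N <= pi.
  rewrite ler_pdivrMr// mulrC -ler_pdivrMr//; apply: ltW.
  apply: lt_le_trans (truncnS_gt _) _; rewrite ler_nat ltnS.
  by rewrite (leq_trans xm)// leq_addr.
have xN0 : 0 <= `|x - z| / N by rewrite divr_ge0// ltW.
have -> : (c m <= (1 + cos ((x - z) / N)) / 2) = (`|x - z| <= r).
  rewrite /c ler_pM2r ?invr_gt0// lerD2l -[cos ((x - z) / N)]cos_norm normrM normfV.
  rewrite (gtr0_norm N0) -/N leNgt ltr_cos ?in_itv/= ?rm0 ?(ltW (rm m)) ?xN0 ?xN//.
  by rewrite -leNgt ler_pM2r ?invr_gt0.
rewrite indicE; congr (_ %:R); congr nat_of_bool.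
by rewrite mem_setE in_itv/= ler_norml /z /r; apply/idP/idP; lra.
Qed.

(** The half-open interval is an increasing union of closed ones. Half-open intervals are the
    intersection-stable generators to which uniqueness of measures is applied. *)
Lemma same_itvoc a b : a < b -> same_integral (\1_(`]a, b])).
Proof.
move=> ab; apply: (@same_cvg (fun n => \1_(`[a + (b - a) / n.+1%:R, b]))).
  move=> n; apply: same_itvcc.
  have : (b - a) / n.+1%:R <= b - a by rewrite ler_pdivrMr// ler_peMr ?ler1n//; lra.
    move: (_ / n.+1%:R) => q; lra.
move=> x; apply: cvg_near_cst.
exists (Num.truncn ((b - a) / (x - a))) => // n /= xn.
rewrite !indicE !mem_setE !in_itv/=; congr (_ %:R); congr nat_of_bool; congr andb.
have n0 : 0 < n.+1%:R :> R by rewrite ltr0n.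
apply/idP/idP => [h|ax].
  have : 0 < (b - a) / n.+1%:R by rewrite divr_gt0//; lra.
  by move: (_ / n.+1%:R) h => q h; lra.
rewrite -lerBrDl ler_pdivrMr// mulrC -ler_pdivrMr ?subr_gt0//.
by apply/ltW/(lt_le_trans (truncnS_gt _)); rewrite ler_nat ltnS.
Qed.

Lemma same_measure_itvoc a b : a < b ->
  mu (`]a, b]%classic : set (measurableTypeR R)) = nu `]a, b]%classic.
Proof.
move=> /same_itvoc; case=> _ _ E.
have {}E := congr1 EFin E; move: E.
rewrite /Rintegral !integral_indic//= !setIT.
by rewrite !fineK// fin_num_measure.
Qed.

Theorem characteristic_function_unique (A : set (measurableTypeR R)) :
  measurable A -> mu A = nu A.
Proof.
pose g (n : nat) : set (measurableTypeR R) := `](- n%:R), n%:R]%classic.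
move=> mA; have := @measure_unique _ R (measurableTypeR R) (@ocitv R) g _ _ _ _ mu nu;
  apply => //.
- exact: ocitvI.
- by move=> n; exact: is_ocitv.
- rewrite -subTset => x _; exists (Num.truncn `|x|).+1 => //=.
  have : `|x| < (Num.truncn `|x|).+1%:R by exact: truncnS_gt.
  by rewrite /g/= in_itv/= ltr_norml => /andP[-> /ltW].
- move=> B [[a b]] /= _ <-.
  have [ab|ba] := ltP a b; last by rewrite set_itv_ge ?measure0// bnd_simp -leNgt.
  exact: same_measure_itvoc.
- by move=> k; rewrite -ge0_fin_numE // fin_num_measure //; exact: measurable_itv.
Qed.

End Uniqueness.

(** * The characteristic function of a normal law *)

Lemma is_derive_affine {R : realType} (a b x : R) :
  is_derive x 1 (fun y => a * y + b) a.
Proof.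
have -> : (fun y => a * y + b) = (a *: (@id R : R -> R)) + cst b.
  by apply/funext => y; rewrite !fctE.
by apply: is_derive_eq; rewrite addr0 [_ *: _]mulr1.
Qed.

Section NormalCharacteristic.
Context {R : realType}.
Variables (m s : R).
Hypothesis s0 : 0 < s.
Local Notation mu := (@lebesgue_measure R).
Local Notation p := (normal_pdf m s).
Implicit Types (t c x y : R).

(** Change of measure through the Radon-Nikodym derivative, which agrees with the density almost
    everywhere because both have the same integral over every measurable set. *)
Lemma Rintegral_normal_prob (f : measurableTypeR R -> R) : bmeas f ->
  \int[normal_prob m s]_x f x = \int[mu]_x (f x * p x).
Proof.
move=> bf; have [mf _] := bf.
have dom := normal_prob_dominates m s.
congr fine.
have intf : (normal_prob m s).-integrable setT (EFin \o f) by exact: bmeas_integrable.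
rewrite -(Radon_Nikodym_change_of_variables dom)//=.
apply: ae_eq_integral => //.
- by apply: emeasurable_funM => //; exact/measurable_EFinP.
- apply/measurable_EFinP/measurable_funM => //; exact: measurable_normal_pdf.
- under [X in ae_eq _ _ _ X]eq_fun do rewrite EFinM.
  apply: ae_eqe_mul2l => /=.
  rewrite Radon_NikodymE//=.
  case: cid => /= h [h1 h2 h3].
  apply: integral_ae_eq => //=.
  + by apply/measurable_EFinP; exact: measurable_normal_pdf.
  + by move=> E E01 mE; rewrite -h3.
Qed.

Let sn0 : s != 0. Proof. by rewrite gt_eqF. Qed.

Lemma is_derive_normal_pdf x : is_derive x 1 p (- (x - m) / s ^+ 2 * p x).
Proof.
have d1 : is_derive x 1 (fun x : R => 1 * x + - m) 1 := is_derive_affine 1 (- m) x.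
have d2 : is_derive x 1 ((fun x : R => 1 * x + - m) * (fun x : R => 1 * x + - m)) (2 * (x - m)).
  by apply: is_derive_eq; rewrite /GRing.scale/=; ring.
have d3 : is_derive x 1 (expR \o (fun y => (- (s ^+ 2 *+ 2)^-1) * y + 0) \o
    ((fun x : R => 1 * x + - m) * (fun x : R => 1 * x + - m)))
    (expR (- (s ^+ 2 *+ 2)^-1 * ((1 * x + - m) * (1 * x + - m)) + 0) *
      - (s ^+ 2 *+ 2)^-1 * (2 * (x - m))).
  apply: is_derive1_comp; apply: is_derive1_comp; exact: is_derive_affine.
have d4 := is_deriveZ (normal_peak s) d3.
have -> : p = normal_peak s *: (expR \o (fun y => (- (s ^+ 2 *+ 2)^-1) * y + 0) \o
    ((fun x : R => 1 * x + - m) * (fun x : R => 1 * x + - m))).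
  rewrite normal_pdfE//; apply/funext => y; rewrite !fctE/= /normal_fun /GRing.scale/=;
    congr (_ * expR _).
  by ring.
apply: (is_derive_eq d4); rewrite !fctE /GRing.scale/=.
by rewrite -mulr_natr; field; exact: sn0.
Qed.

(** Half of the Gaussian exponent absorbs the linear factor, through 2 v <= 1 + v ^ 2 <= exp (v ^ 2)
    at v = |x - m| / (2 s); the other half is a normal density of deviation sqrt 2 * s. This
    dominates the first absolute moment. *)
Lemma abs_normal_pdf_le x :
  `|x - m| * p x <= s * normal_peak s / normal_peak (Num.sqrt 2 * s) * normal_pdf m (Num.sqrt 2 * s) x.
Proof.
have q0 : Num.sqrt 2 * s != 0 by rewrite mulf_neq0// sqrtr_eq0 -ltNge.
rewrite !normal_pdfE// [leRHS]mulrA divfK ?gt_eqF ?normal_peak_gt0//.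
rewrite mulrCA -[leRHS]mulrA [leRHS]mulrCA ler_wpM2l ?normal_peak_ge0//.
rewrite /normal_fun exprMn sqr_sqrtr//.
pose w := (x - m) ^+ 2 / (s ^+ 2 *+ 4).
have s2 : s ^+ 2 != 0 by rewrite expf_neq0.
have -> : - (x - m) ^+ 2 / (s ^+ 2 *+ 2) = - w + - w.
  by rewrite /w -!(mulr_natr (_ ^+ 2)) -?(mulr_natr (2 * _)); field.
have -> : - (x - m) ^+ 2 / (2 * s ^+ 2 *+ 2) = - w.
  by rewrite /w -!(mulr_natr (_ ^+ 2)) -?(mulr_natr (2 * _)); field.
rewrite expRD mulrA ler_pM2r ?expR_gt0//.
rewrite expRN ler_pdivrMr ?expR_gt0//.
apply: (@le_trans _ _ (s * (1 + w))); last first.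
  by rewrite ler_pM2l//; exact: expR_ge1Dx.
pose v := `|x - m| / (2 * s).
have wv : w = v ^+ 2.
  by rewrite /v expr_div_n real_normK ?num_real// /w; field.
have -> : `|x - m| = 2 * s * v by rewrite /v; field.
rewrite wv [2 * s]mulrC -mulrA ler_pM2l//.
by have := sqr_ge0 (v - 1); nra.
Qed.

Lemma normal_moment_integrable :
  mu.-integrable setT (EFin \o (fun x => `|x - m| * p x)).
Proof.
set C := s * normal_peak s / normal_peak (Num.sqrt 2 * s).
apply: (@le_integrable _ _ R mu _ measurableT _ (fun x => (C * normal_pdf m (Num.sqrt 2 * s) x)%:E)).
- apply/measurable_EFinP/measurable_funM; last exact: measurable_normal_pdf.
  by apply: measurableT_comp => //; apply: measurable_funB.
- move=> x _; rewrite /= lee_fin ger0_norm; last by rewrite mulr_ge0 ?normal_pdf_ge0.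
  by apply: le_trans (ler_norm _); exact: abs_normal_pdf_le.
- under eq_fun do rewrite EFinM.
  by apply: integrableZl => //; exact: integrable_normal_pdf.
Qed.

Local Notation ph c t := (fun x => t * (x - m) + c).

Lemma measurable_phase (f : R -> R) c t : measurable_fun setT f ->
  measurable_fun setT (fun x => f (ph c t x)).
Proof.
move=> mf; apply: measurableT_comp => //; apply: measurable_funD => //.
by apply: measurable_funM => //; exact: measurable_funB.
Qed.

Lemma integrable_cos_normal c t :
  mu.-integrable setT (EFin \o (fun x => cos (ph c t x) * p x)).
Proof.
apply: (le_integrable measurableT _ _ (integrable_normal_pdf m s)).
- apply/measurable_EFinP/measurable_funM; last exact: measurable_normal_pdf.
  by apply: measurable_phase; apply: continuous_measurable_fun; exact: continuous_cos.
- move=> x _; rewrite /= lee_fin normrM ler_piMl//; exact: cos_max.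
Qed.

Lemma integrable_sin_normal c t :
  mu.-integrable setT (EFin \o (fun x => sin (ph c t x) * ((x - m) * p x))).
Proof.
apply: (le_integrable measurableT _ _ normal_moment_integrable).
- apply/measurable_EFinP/measurable_funM.
    by apply: measurable_phase; apply: continuous_measurable_fun; exact: continuous_sin.
  apply: measurable_funM; last exact: measurable_normal_pdf.
  exact: measurable_funB.
- move=> x _; rewrite /= lee_fin 2!normrM [leRHS]ger0_norm ?mulr_ge0 ?normal_pdf_ge0//.
  by rewrite (ger0_norm (normal_pdf_ge0 _ _ _)) ler_piMl ?mulr_ge0 ?normal_pdf_ge0// sin_max.
Qed.

(** Stein's identity, by integration by parts: [h] is the derivative of [u], which vanishes at both
    infinities, so [h] has integral 0. *)
Lemma normal_stein c t :
  \int[mu]_x (sin (ph c t x) * ((x - m) * p x)) =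
  s ^+ 2 * t * \int[mu]_x (cos (ph c t x) * p x).
Proof.
pose h x := t * (cos (ph c t x) * p x) - (s ^+ 2)^-1 * (sin (ph c t x) * ((x - m) * p x)).
pose u x := sin (ph c t x) * p x.
have i1 : mu.-integrable setT (EFin \o (fun x => t * (cos (ph c t x) * p x))).
  rewrite /comp; under eq_fun do rewrite EFinM.
  by apply: (@integrableZl _ _ R mu _ measurableT) => //; exact: integrable_cos_normal.
have i2 : mu.-integrable setT
    (EFin \o (fun x => (s ^+ 2)^-1 * (sin (ph c t x) * ((x - m) * p x)))).
  rewrite /comp; under eq_fun do rewrite EFinM.
  by apply: (@integrableZl _ _ R mu _ measurableT) => //; exact: integrable_sin_normal.
have ih : mu.-integrable setT (EFin \o h) by exact: (integrableB measurableT i1 i2).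
have du x : is_derive x 1 u (h x).
  have d1 : is_derive x 1 (sin \o (fun x => t * x + (c - t * m))) (cos (t * x + (c - t * m)) * t).
    by apply: is_derive1_comp; exact: is_derive_affine.
  have d2 := is_derive_normal_pdf x.
  have -> : u = (sin \o (fun x => t * x + (c - t * m))) * p.
    by apply/funext => y; rewrite fctE/= /u; congr (sin _ * _); ring.
  have E : t * x + (c - t * m) = ph c t x by ring.
  apply: (is_derive_eq (is_deriveM d1 d2)); rewrite /GRing.scale/= /h E; field.
  exact: sn0.
suff h0 : \int[mu]_x h x = 0.
  move: h0; rewrite /h RintegralB// !RintegralZl//; last 2 first.
  - exact: integrable_sin_normal.
  - exact: integrable_cos_normal.
  move=> /eqP; rewrite subr_eq0 => /eqP.
  move: (\int[mu]_x _) (\int[mu]_x _) => I J E.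
  by apply: (mulfI (_ : (s ^+ 2)^-1 != 0)); rewrite ?invr_eq0 ?expf_neq0// -E; field.
pose I n := `[m - n.+1%:R, m + n.+1%:R]%classic : set R.
have In n : \int[mu]_(x in I n) h x = u (m + n.+1%:R) - u (m - n.+1%:R).
  rewrite /Rintegral (@continuous_FTC2 _ h u)//.
  - by have := ltr0Sn R n; lra.
  - apply: continuous_subspaceT => x; rewrite /h.
    have cp : {for x, continuous p} := @continuous_normal_pdf R m s sn0 x.
    have cph : {for x, continuous (fun x => ph c t x)}.
      apply: cvgD; last exact: cvg_cst.
      apply: cvgM; first exact: cvg_cst.
      by apply: cvgB; [exact: cvg_id | exact: cvg_cst].
    apply: cvgB; apply: cvgM; try exact: cvg_cst.
      apply: cvgM; last exact: cp.
      exact: (continuous_comp cph (@continuous_cos R _)).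
    apply: cvgM; first exact: (continuous_comp cph (@continuous_sin R _)).
    by apply: cvgM; [apply: cvgB; [exact: cvg_id | exact: cvg_cst] | exact: cp].
  - have cu x : {for x, continuous u}.
      by apply/differentiable_continuous/derivable1_diffP; case: (du x).
    split; [by move=> x _; case: (du x) | |].
      by apply: cvg_at_right_filter; exact: cu.
    by apply: cvg_at_left_filter; exact: cu.
  - by move=> x _; rewrite derive1E; case: (du x).
have cvI : (fun n => \int[mu]_(x in I n) h x) @ \oo --> \int[mu]_x h x.
  have -> : (fun n => \int[mu]_(x in I n) h x) = (fun n => \int[mu]_x (h \_ (I n)) x).
    by apply/funext => n; rewrite Rintegral_mkcond.
  apply: fine_cvg; rewrite /Rintegral fineK; last exact: integrable_fin_num.
  have mh : measurable_fun setT h by have /integrableP[/measurable_EFinP] := ih.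
  apply: (@dominated_cvg _ _ _ mu setT _ (fun n x => ((h \_ (I n)) x)%:E) _ (abse \o (EFin \o h))) => //.
  - move=> n; apply/measurable_EFinP.
    apply/(measurable_restrictT _ _).1 => //; first exact: measurable_itv.
    exact: measurable_funTS.
  - move=> x _; apply: cvg_EFin; first exact: nearW.
    apply: cvg_near_cst; exists (Num.truncn `|x - m|) => // n /= xn.
    rewrite patchE mem_set// /I/= in_itv/=.
    have : `|x - m| <= n.+1%:R.
      by apply/ltW/(lt_le_trans (truncnS_gt _)); rewrite ler_nat ltnS.
    by rewrite ler_norml; lra.
  - exact: integrable_abse.
  - by move=> n x _; rewrite patchE /=; case: ifP => _; rewrite ?normr0 lee_fin.
(* Boundedness of |x - m| * p x makes the boundary terms of order 1 / (n + 1) at the ends of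
   [I n]. *)
pose C := s * normal_peak s / normal_peak (Num.sqrt 2 * s) * normal_peak (Num.sqrt 2 * s).
have pC x : `|x - m| * p x <= C.
  apply: (le_trans (abs_normal_pdf_le x)); apply: ler_wpM2l.
    by rewrite divr_ge0 ?mulr_ge0 ?normal_peak_ge0// ltW.
  by apply: normal_pdf_ub; rewrite mulf_neq0// sqrtr_eq0 -ltNge.
have uC x (n : nat) : `|x - m| = n.+1%:R -> `|u x| <= C * harmonic n.
  move=> xn; rewrite /harmonic/= ler_pdivlMr ?ltr0Sn// mulrC -xn.
  apply: le_trans (pC x); rewrite ler_wpM2l// /u normrM.
  rewrite [X in _ * X]ger0_norm ?normal_pdf_ge0// ler_piMl ?normal_pdf_ge0//.
  exact: sin_max.
apply/eqP; rewrite -normr_eq0; apply/eqP.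
have nI : (fun n => `|\int[mu]_(x in I n) h x|) @ \oo --> `|\int[mu]_x h x|.
  exact: cvg_norm.
apply: (@cvg_unique _ _ _ _ _ _ nI); first exact: norm_hausdorff.
apply: (@squeeze_cvgr _ _ _ _ (fun=> 0) (fun n => (C + C) * harmonic n)); last 2 first.
- exact: cvg_cst.
- by rewrite -[X in _ --> X](mulr0 (C + C)); apply: cvgMr; exact: cvg_harmonic.
apply: nearW => n; rewrite normr_ge0/= In (le_trans (ler_normB _ _))// mulrDl lerD//.
  by apply: uC; rewrite addrAC subrr add0r ger0_norm.
by apply: uC; rewrite addrAC subrr add0r normrN ger0_norm.
Qed.

Let H c t := \int[mu]_x (cos (ph c t x) * p x).

Lemma is_derive_normal_phase c t : is_derive t 1 (H c) (- (s ^+ 2 * t) * H c t).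
Proof.
pose f t x := cos (ph c t x) * p x.
have df t' x : is_derive t' 1 (f ^~ x) (- (sin (ph c t' x) * ((x - m) * p x))).
  have d1 : is_derive t' 1 (cos \o (fun y => (x - m) * y + c)) (- sin ((x - m) * t' + c) * (x - m)).
    by apply: is_derive1_comp; exact: is_derive_affine.
  have -> : f ^~ x = p x *: (cos \o (fun y => (x - m) * y + c)).
    by apply/funext => y; rewrite !fctE/= /f mulrC [y * _]mulrC.
  by apply: (is_derive_eq (is_deriveZ (p x) d1)); rewrite /GRing.scale/= [t' * _]mulrC;
    ring.
have Ia : `]t - 1, t + 1[%classic t by rewrite /= in_itv/=; lra.
have intf x : `]t - 1, t + 1[%classic x -> mu.-integrable setT (EFin \o f x).
  by move=> _; exact: integrable_cos_normal.
have derf x y : `]t - 1, t + 1[%classic x -> setT y -> derivable (f ^~ y) x 1.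
  by move=> _ _; case: (df x y).
have G0 y : 0 <= `|y - m| * p y by rewrite mulr_ge0 ?normal_pdf_ge0.
have dfE x y : partial1of2 f x y = - (sin (ph c x y) * ((y - m) * p y)).
  by rewrite partial1of2E; case: (df x y).
have Gub x y : `]t - 1, t + 1[%classic x -> setT y -> `|partial1of2 f x y| <= `|y - m| * p y.
  move=> _ _; rewrite dfE normrN 2!normrM (ger0_norm (normal_pdf_ge0 _ _ _)).
  by rewrite ler_piMl ?sin_max.
have dH := @derivable_under_integral R _ _ mu f setT measurableT t _ _ Ia intf derf _ G0 normal_moment_integrable Gub.
have eH := @differentiation_under_integral R _ _ mu f setT measurableT t _ _ Ia intf derf _ G0 normal_moment_integrable Gub.
apply: DeriveDef; first exact: dH.
rewrite -derive1E eH.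
under eq_Rintegral do rewrite dfE -mulN1r.
rewrite RintegralZl//; last exact: integrable_sin_normal.
by rewrite normal_stein mulN1r mulNr.
Qed.

(** By the differential equation H' = - s^2 t H, the product [K] is constant. The free phase c later
    absorbs the mean, and a shift by pi / 2 turns the cosine into a sine. *)
Lemma normal_phaseE c t : H c t = expR (- (s ^+ 2 / 2 * t ^+ 2)) * cos c.
Proof.
pose K t := expR (s ^+ 2 / 2 * t ^+ 2) * H c t.
have dK t' : is_derive t' 1 K 0.
  have d1 : is_derive t' 1 (expR \o ((fun y => s ^+ 2 / 2 * y + 0) * (fun y => 1 * y + 0)))
      (expR ((s ^+ 2 / 2 * t' + 0) * (1 * t' + 0)) * ((s ^+ 2 / 2 * t' + 0) *: 1 + (1 * t' + 0) *: (s ^+ 2 / 2))).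
    apply: is_derive1_comp.
    by apply: is_deriveM; exact: is_derive_affine.
  have -> : K = (expR \o ((fun y => s ^+ 2 / 2 * y + 0) * (fun y => 1 * y + 0))) * H c.
    by apply/funext => y; rewrite !fctE/= /K; congr (expR _ * _); ring.
  apply: (is_derive_eq (is_deriveM d1 (is_derive_normal_phase c t'))).
  by rewrite /GRing.scale/= !fctE; field.
have H0 : H c 0 = cos c.
  rewrite /H; under eq_Rintegral do rewrite mul0r add0r.
  rewrite RintegralZl//; last exact: integrable_normal_pdf.
  by rewrite /Rintegral integral_normal_pdf mulr1.
have := is_derive_0_is_cst t 0 dK; rewrite /K expr0n mulr0 expR0 mul1r H0 => <-.
by rewrite mulrA -expRD addNr expR0 mul1r.
Qed.

Lemma normal_prob_cos t :
  \int[normal_prob m s]_x cos (t * x) = expR (- (s ^+ 2 / 2 * t ^+ 2)) * cos (m * t).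
Proof.
rewrite Rintegral_normal_prob; last first.
  by apply: bmeas_cos; apply: measurable_funM => //; exact: measurable_cst.
rewrite -normal_phaseE; apply: eq_Rintegral => x _; congr (cos _ * _); ring.
Qed.

Lemma normal_prob_sin t :
  \int[normal_prob m s]_x sin (t * x) = expR (- (s ^+ 2 / 2 * t ^+ 2)) * sin (m * t).
Proof.
rewrite Rintegral_normal_prob; last first.
  by apply: bmeas_sin; apply: measurable_funM => //; exact: measurable_cst.
rewrite -cosBpihalf -normal_phaseE; apply: eq_Rintegral => x _.
by rewrite -cosBpihalf; congr (cos _ * _); ring.
Qed.

End NormalCharacteristic.

(** * Independence and characteristic functions *)

Section IndicatorToBounded.
Context d (T : measurableType d) (R : realType) (P : probability T R).

(** The sum counts the levels below y, so it is the integer part of (n + 1) * y. *)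
Lemma layer_sum (n : nat) (y : R) : 0 <= y <= 1 ->
  `|y - n.+1%:R^-1 * \sum_(k < n.+1) (k.+1%:R / n.+1%:R <= y)%R%:R| <= harmonic n.
Proof.
move=> /andP[y0 y1]; have n0 : 0 < n.+1%:R :> R by rewrite ltr0n.
have -> : \sum_(k < n.+1) (k.+1%:R / n.+1%:R <= y)%R%:R
  = (Num.truncn (n.+1%:R * y))%:R :> R.
  have cnt (N m : nat) : (\sum_(k < m) (k < N) = minn m N)%N.
    elim: m => [|m IH]; first by rewrite big_ord0 min0n.
    by rewrite big_ord_recr/= IH; case: (ltnP m N) => mN; lia.
  have tn : (Num.truncn (n.+1%:R * y) <= n.+1)%N.
    rewrite truncn_le_nat -[ltRHS]natr1; apply: (@le_lt_trans _ _ n.+1%:R); last by lra.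
    by rewrite ler_piMr.
  rewrite -[in RHS](minn_idPr tn) -cnt natr_sum.
  apply: eq_bigr => k _; congr (_ %:R); congr nat_of_bool.
  by rewrite ler_pdivrMr// mulrC truncn_gt_nat.
have ny0 : 0 <= n.+1%:R * y by rewrite mulr_ge0.
have h1 : (Num.truncn (n.+1%:R * y))%:R <= n.+1%:R * y by rewrite truncn_le.
have h2 := truncnS_gt (n.+1%:R * y).
have -> : harmonic n = n.+1%:R^-1 * 1 :> R by rewrite mulr1.
have -> : y = n.+1%:R^-1 * (n.+1%:R * y) by rewrite mulKf// gt_eqF.
rewrite -mulrBr normrM gtr0_norm ?invr_gt0// ler_pM2l ?invr_gt0//.
rewrite mulVKf ?gt_eqF// ler_norml; move: h1 h2; rewrite -natr1.
by set X := (Num.truncn _)%:R; lra.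
Qed.

Variables (Y W : T -> R) (v : R).
Hypotheses (mY : measurable_fun setT Y) (bW : bmeas W).
Hypothesis ind : forall A : set R, measurable A ->
  \int[P]_w (\1_A (Y w) * W w) = v * \int[P]_w \1_A (Y w).

Let factors (g : R -> R) := \int[P]_w (g (Y w) * W w) = v * \int[P]_w g (Y w).

Let bY (g : measurableTypeR R -> R) : bmeas g -> bmeas (fun w => g (Y w)).
Proof.
by move=> [mg [M gM]]; split; [exact: measurableT_comp | exists M].
Qed.

(** A layer-cake argument: g is a uniform limit of averages of indicators of its superlevel sets,
    which factor by [ind] and linearity. *)
Lemma factors_unit (g : measurableTypeR R -> R) :
  measurable_fun setT g -> (forall x, 0 <= g x <= 1) -> factors g.
Proof.
move=> mg g01.
pose A n (k : 'I_n.+1) : set R := g @^-1` `[k.+1%:R / n.+1%:R, +oo[.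
have mA n k : measurable (A n k).
  by rewrite -[X in measurable X]setTI; apply: mg => //; exact: measurable_itv.
pose g_ (n : nat) (x : R) : R := n.+1%:R^-1 * \sum_(k < n.+1) \1_(A n k) x.
have g_E n x : g_ n x = n.+1%:R^-1 * \sum_(k < n.+1) (k.+1%:R / n.+1%:R <= g x)%R%:R.
  rewrite /g_; congr (_ * _); apply: eq_bigr => k _.
  rewrite indicE; congr (_ %:R); congr nat_of_bool.
  apply/idP/idP => [/set_mem|h]; first by rewrite /A/= in_itv/= andbT.
  by apply/mem_set; rewrite /A/= in_itv/= andbT.
have close n x : `|g x - g_ n x| <= harmonic n by rewrite g_E; exact: layer_sum.
have bi n k : bmeas (fun w => \1_(A n k) (Y w) : R).
  apply: (bY (g := \1_(A n k))); split; first by apply: measurable_indic; exact: mA.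
  by exists 1 => x; rewrite indicE; case: (_ \in _); rewrite ?normr1 ?normr0.
have fg_ n : factors (g_ n).
  rewrite /factors /g_.
  have bsum (r : seq 'I_n.+1) : bmeas (fun w => \sum_(k <- r) \1_(A n k) (Y w) : R).
    elim: r => [|k r IH].
      by under eq_fun do rewrite big_nil; exact: bmeas_cst.
    by under eq_fun do rewrite big_cons; exact: bmeasD.
  under eq_Rintegral do rewrite -mulrA.
  rewrite !RintegralZl//; [|exact/bmeas_integrable/bsum|exact/bmeas_integrable/bmeasM].
  rewrite mulrCA; congr (_ * _).
  elim: (index_enum _) => [|k r IH].
    under eq_Rintegral do rewrite big_nil mul0r.
    under [in RHS]eq_Rintegral do rewrite big_nil.
    by rewrite Rintegral_cst// mul0r mulr0.
  under eq_Rintegral do rewrite big_cons mulrDl.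
  under [in RHS]eq_Rintegral do rewrite big_cons.
  rewrite !RintegralD//; try by apply/bmeas_integrable => //; apply: bmeasM.
  by rewrite IH ind// mulrDr.
have gb n x : `|g_ n x| <= 2.
  have := close n x; have := g01 x.
  have : harmonic n <= 1 :> R by rewrite invf_le1 ?ler1n ?ltr0n.
  by rewrite !ler_norml; lra.
have cg x : g_ ^~ x @ \oo --> g x.
  apply/cvgrPdist_le => e e0.
  have /cvgrPdist_le/(_ _ e0) := @cvg_harmonic R.
  apply: filterS => n; rewrite sub0r normrN => hn.
  by apply: (le_trans (close n x)); apply: le_trans hn; exact: ler_norm.
have mg_ n : measurable_fun setT (g_ n : measurableTypeR R -> R).
  apply: measurable_funM; first exact: measurable_cst.
  by apply: measurable_sum => k; apply: measurable_indic; exact: mA.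
have [mW [M WM]] := bW.
have c1 : (fun n => \int[P]_w (g_ n (Y w) * W w)) @ \oo --> \int[P]_w (g (Y w) * W w).
  apply: (@bounded_cvg_Rintegral _ _ _ P _ _ (2 * M)).
  - by move=> n; apply: measurable_funM => //; exact: (measurableT_comp (mg_ n) mY).
  - by move=> n w; rewrite normrM ler_pM.
  - by move=> w; apply: cvgM; [exact: cg | exact: cvg_cst].
have c2 : (fun n => v * \int[P]_w g_ n (Y w)) @ \oo --> v * \int[P]_w g (Y w).
  apply: cvgM; first exact: cvg_cst.
  apply: (@bounded_cvg_Rintegral _ _ _ P _ _ 2) => //.
  by move=> n; exact: (measurableT_comp (mg_ n) mY).
apply: (@cvg_unique _ _ _ _ _ _ c1); first exact: norm_hausdorff.
rewrite (_ : (fun n => _) = (fun n => v * \int[P]_w g_ n (Y w))) //.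
by apply/funext => n; exact: fg_.
Qed.

Lemma indicator_to_bounded (g : measurableTypeR R -> R) : bmeas g ->
  \int[P]_w (g (Y w) * W w) = v * \int[P]_w g (Y w).
Proof.
move=> bg; have [mg [M0 gM0]] := bg.
(* The added 1 keeps M positive, so that the affine change [h] maps into [0, 1]. *)
pose M := M0 + 1.
have gM x : `|g x| <= M by rewrite (le_trans (gM0 x))// /M; lra.
have M0' : 0 < M by have := gM0 0; have := normr_ge0 (g 0); rewrite /M; lra.
pose h x := (2 * M)^-1 * (g x + M).
have bh : bmeas (h : measurableTypeR R -> R).
  by apply: bmeasM; [exact: bmeas_cst | apply: bmeasD => //; exact: bmeas_cst].
have h01 x : 0 <= h x <= 1.
  have := gM x; rewrite ler_norml => /andP[l r]; apply/andP; split.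
    by rewrite mulr_ge0 ?invr_ge0//; lra.
  by rewrite /h mulrC ler_pdivrMr; lra.
have fh : factors h by apply: factors_unit h01; case: bh.
have f1 : factors (fun=> 1).
  by apply: factors_unit => [|x]; [exact: measurable_cst | lra].
have b1 : bmeas (fun w => g (Y w)) := bY bg.
have bhY : bmeas (fun w => h (Y w)) := bY bh.
have -> : \int[P]_w (g (Y w) * W w) =
    (2 * M) * \int[P]_w (h (Y w) * W w) - M * \int[P]_w (1 * W w).
  rewrite -!RintegralZl//; last 2 first.
  - by apply/bmeas_integrable/bmeasM => //; exact: bmeas_cst.
  - exact/bmeas_integrable/bmeasM.
  rewrite -RintegralB//; last 2 first.
  - by apply/bmeas_integrable/bmeasM; [exact: bmeas_cst | exact: bmeasM].
  - by apply/bmeas_integrable/bmeasM; [exact: bmeas_cst | apply: bmeasM => //;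
    exact: bmeas_cst].
  by apply: eq_Rintegral => w _; rewrite /h; field; rewrite gt_eqF.
have -> : \int[P]_w g (Y w) =
    (2 * M) * \int[P]_w h (Y w) - M * \int[P]_w 1.
  rewrite -!RintegralZl//; last 2 first.
  - exact/bmeas_integrable/bmeas_cst.
  - exact/bmeas_integrable.
  rewrite -RintegralB//; last 2 first.
  - by apply/bmeas_integrable/bmeasM; [exact: bmeas_cst | ].
  - by apply/bmeas_integrable/bmeasM; exact: bmeas_cst.
  by apply: eq_Rintegral => w _; rewrite /h; field; rewrite gt_eqF.
by rewrite fh f1; ring.
Qed.

End IndicatorToBounded.

Section ComplexExpectation.
Context d (T : measurableType d) (R : realType).

Definition cbmeas (f : T -> R[i]) :=
  bmeas (fun x => Re (f x)) /\ bmeas (fun x => Im (f x)).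

Lemma cbmeasM (f g : T -> R[i]) :
  cbmeas f -> cbmeas g -> cbmeas (fun x => f x * g x).
Proof.
move=> [fr fi] [gr gi]; split.
  have -> : (fun x => Re (f x * g x))
    = (fun x => Re (f x) * Re (g x) - Im (f x) * Im (g x)).
    by apply/funext => x; case: (f x) (g x) => [a b] [c e].
  by apply: bmeasB; exact: bmeasM.
have -> : (fun x => Im (f x * g x)) = (fun x => Re (f x) * Im (g x) + Im (f x) * Re (g x)).
  by apply/funext => x; case: (f x) (g x) => [a b] [c e].
by apply: bmeasD; exact: bmeasM.
Qed.

Lemma cbmeas_real (f : T -> R) : bmeas f -> cbmeas (fun x => (f x)%:C).
Proof. by move=> bf; split => //; exact: bmeas_cst. Qed.

Lemma cbmeas_prod (I : Type) (r : seq I) (Q : pred I) (f : I -> T -> R[i]) :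
  (forall i, cbmeas (f i)) -> cbmeas (fun x => \prod_(i <- r | Q i) f i x).
Proof.
move=> bf; elim: r => [|i r IH].
  under eq_fun do rewrite big_nil; exact/(cbmeas_real (f := fun=> 1))/bmeas_cst.
have -> : (fun x => \prod_(k <- i :: r | Q k) f k x) =
    (fun x => if Q i then f i x * \prod_(k <- r | Q k) f k x else \prod_(k <- r | Q k) f k x).
  by apply/funext => x; rewrite big_cons.
by case: (Q i) => //; exact: cbmeasM.
Qed.

Lemma cbmeas_cis (f : T -> R) : measurable_fun setT f -> cbmeas (fun x => cis (f x)).
Proof. by move=> mf; split; [exact: bmeas_cos | exact: bmeas_sin]. Qed.

Variable P : probability T R.

Definition cexpectation (f : T -> R[i]) : R[i] :=
  (\int[P]_x Re (f x)) +i* (\int[P]_x Im (f x)).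

Lemma eq_cexpectation (f g : T -> R[i]) : (forall x, f x = g x) ->
  cexpectation f = cexpectation g.
Proof. by move=> fg; congr cexpectation; apply/funext. Qed.

Lemma cexpectation_real (f : T -> R) :
  cexpectation (fun x => (f x)%:C) = (\int[P]_x f x)%:C.
Proof. by rewrite /cexpectation/= Rintegral_cst// mul0r. Qed.

End ComplexExpectation.

Section IndependentProduct.
Context d (T : measurableType d) (R : realType) (P : probability T R).
Local Notation EC := (cexpectation P).

Lemma cbmeas_comp (f : measurableTypeR R -> R[i]) (X : {RV P >-> R}) :
  cbmeas f -> cbmeas (fun w => f (X w)).
Proof.
have mX : measurable_fun setT X by exact: measurable_funP.
move=> [[mr [M rM]] [mi [N iN]]]; split; split; try by [exists M | exists N].
  exact: (measurableT_comp mr mX).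
exact: (measurableT_comp mi mX).
Qed.

Lemma cexpectation_factor (Y : {RV P >-> R}) (W : T -> R[i]) (V : R[i])
    (f : measurableTypeR R -> R[i]) :
  cbmeas W -> cbmeas f ->
  (forall A : set R, measurable A ->
     EC (fun w => (\1_A (Y w))%:C * W w) = EC (fun w => (\1_A (Y w))%:C) * V) ->
  EC (fun w => f (Y w) * W w) = EC (fun w => f (Y w)) * V.
Proof.
move=> bW bf ind; have mY : measurable_fun setT Y by exact: measurable_funP.
have [bWr bWi] := bW; have [bfr bfi] := bf.
have [bYr bYi] := cbmeas_comp Y bf.
have indr (A : set R) : measurable A ->
    \int[P]_w (\1_A (Y w) * Re (W w)) = Re V * \int[P]_w \1_A (Y w).
  move=> mA; have := congr1 Re (ind A mA); rewrite cexpectation_real /cexpectation.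
  case: V {ind} => a b /=; rewrite mul0r subr0 mulrC => <-.
  by apply: eq_Rintegral => w _; case: (W w) => x y /=; rewrite mul0r subr0.
have indi (A : set R) : measurable A ->
    \int[P]_w (\1_A (Y w) * Im (W w)) = Im V * \int[P]_w \1_A (Y w).
  move=> mA; have := congr1 Im (ind A mA); rewrite cexpectation_real /cexpectation.
  case: V {ind indr} => a b /=; rewrite mul0r addr0 mulrC => <-.
  by apply: eq_Rintegral => w _; case: (W w) => x y /=; rewrite mul0r addr0.
have Fr g bg := indicator_to_bounded mY bWr indr (g := g) bg.
have Fi g bg := indicator_to_bounded mY bWi indi (g := g) bg.
rewrite /cexpectation.
have -> : \int[P]_w Re (f (Y w) * W w) =
   \int[P]_w (Re (f (Y w)) * Re (W w)) - \int[P]_w (Im (f (Y w)) * Im (W w)).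
  rewrite -RintegralB//; try by apply/bmeas_integrable/bmeasM.
  by apply: eq_Rintegral => w _; case: (f _) (W w) => [a b] [x y].
have -> : \int[P]_w Im (f (Y w) * W w) =
   \int[P]_w (Re (f (Y w)) * Im (W w)) + \int[P]_w (Im (f (Y w)) * Re (W w)).
  rewrite -RintegralD//; try by apply/bmeas_integrable/bmeasM.
  by apply: eq_Rintegral => w _; case: (f _) (W w) => [a b] [x y].
rewrite (Fr _ bfr) (Fi _ bfi) (Fi _ bfr) (Fr _ bfi).
case: V {ind indr indi Fr Fi} => a b /=; simpc.
by congr (_ +i* _); ring.
Qed.

(** The factors are freed one coordinate at a time: outside the list [r] they are still indicators.
    For empty [r] this is the definition of independence; each further coordinate is released by
    [cexpectation_factor]. *)
Lemma cexpectation_prod (I : finType) (X : I -> {RV P >-> R})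
    (f : I -> measurableTypeR R -> R[i]) :
  mutually_independent P X -> (forall i, cbmeas (f i)) ->
  EC (fun w => \prod_i f i (X i w)) = \prod_i EC (fun w => f i (X i w)).
Proof.
move=> indX bf.
suff main (r : seq I) : forall f : I -> measurableTypeR R -> R[i],
   (forall i, cbmeas (f i)) ->
   (forall i, i \notin r -> exists A : set R, measurable A /\ forall x, f i x
     = (\1_A x)%:C) ->
   EC (fun w => \prod_i f i (X i w)) = \prod_i EC (fun w => f i (X i w)).
  by apply: (main (enum I)) => // i; rewrite mem_enum.
elim: r {f bf} => [|j r IH] f bf indf.
  have /choice[A AE] : forall i, exists A : set R, measurable A /\ forall x, f i x
    = (\1_A x)%:C.
    by move=> i; exact: indf.
  have mA i : measurable (A i) by case: (AE i).
  have fE i x : f i x = (\1_(A i) x)%:C by case: (AE i).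
  have mXA i : measurable (X i @^-1` A i) by exact: measurable_funPTI.
  pose B := \bigcap_(i in [set` [set: I]%SET]) (X i @^-1` A i).
  have mB : measurable B by apply: fin_bigcap_measurable => // i _; exact: mXA.
  have Ei i : EC (fun w => f i (X i w)) = (fine (P (X i @^-1` A i)))%:C.
    under eq_cexpectation do rewrite fE.
    rewrite cexpectation_real; congr (_%:C).
    rewrite /Rintegral -[in RHS](setIT (X i @^-1` A i)) -integral_indic//.
  under [RHS]eq_bigr do rewrite Ei.
  have -> : EC (fun w => \prod_i f i (X i w)) = EC (fun w => (\1_B w)%:C).
    apply: eq_cexpectation => w; under eq_bigr do rewrite fE.
    rewrite -rmorph_prod; congr (_%:C).
    rewrite /indic; case: (boolP (w \in B)) => [/set_mem wB|/negP nB].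
      by rewrite big1// => i _; rewrite mem_set//; apply: wB; rewrite /= inE.
    have [i iA] : exists i, ~ (X i @^-1` A i) w.
      by apply/existsNP => H; apply: nB; apply/mem_set => i _; exact: H.
    by rewrite (bigD1 i)//= memNset ?mul0r.
  rewrite cexpectation_real /Rintegral integral_indic// setIT -rmorph_prod.
  congr (_%:C); transitivity (fine (\prod_i P (X i @^-1` A i))%E).
    congr fine; apply: (etrans (indX [set: I]%SET A mA)).
    by apply: eq_bigl => i; rewrite inE.
  have -> : (\prod_i P (X i @^-1` A i) = \prod_i (fine (P (X i @^-1` A i)))%:E)%E.
    by apply: eq_bigr => i _; rewrite fineK// fin_num_measure.
  by rewrite prodEFin.
rewrite (bigD1 j)//=.
pose W w := \prod_(i | i != j) f i (X i w).
rewrite (@eq_cexpectation _ _ _ P _ (fun w => f j (X j w) * W w)); last first.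
  by move=> w; rewrite (bigD1 j).
apply: (@cexpectation_factor (X j) W _ (f j)) => //.
  apply: (@cbmeas_prod _ _ _ I _ _ (fun i w => f i (X i w))) => i.
  exact: cbmeas_comp.
move=> A mA.
(* Testing [X j] against an indicator takes j off the list, so the induction hypothesis applies to
   [g]. *)
pose g i := if i == j then (fun x => (\1_A x)%:C) else f i.
have bg i : cbmeas (g i).
  rewrite /g; case: eqP => _; last exact: bf.
  apply: cbmeas_real; split; first exact: measurable_indic.
  by exists 1 => x; rewrite indicE; case: (_ \in _); rewrite ?normr1 ?normr0.
have gj : g j = (fun x => (\1_A x)%:C) by rewrite /g eqxx.
have gn i : i != j -> g i = f i by rewrite /g => /negbTE ->.
have E : EC (fun w => \prod_i g i (X i w)) = \prod_i EC (fun w => g i (X i w)).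
  apply: IH => // i ir; have [->|ij] := eqVneq i j; first by exists A; rewrite gj.
  by rewrite gn//; apply: indf; rewrite inE negb_or ij.
transitivity (EC (fun w => \prod_i g i (X i w))).
  apply: eq_cexpectation => w; rewrite (bigD1 j)//= gj; congr (_ * _).
  by apply: eq_bigr => i /gn ->.
rewrite E (bigD1 j)//= gj; congr (_ * _).
by apply: eq_bigr => i /gn ->.
Qed.

End IndependentProduct.

(** * Characteristic functions of real random variables *)

Section CharacteristicFunction.
Context d (T : measurableType d) (R : realType) (P : probability T R).
Local Notation EC := (cexpectation P).

Definition charfun (X : {RV P >-> R}) (t : R) : R[i] := EC (fun w => cis (t * X w)).

Variable X : {RV P >-> R}.

Let mX : measurable_fun setT X. Proof. exact: measurable_funP. Qed.

Let mtX t : measurable_fun setT (fun w => t * X w).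
Proof. by apply: measurable_funM => //; exact: measurable_cst. Qed.

Lemma charfun0 : charfun X 0 = 1.
Proof.
rewrite /charfun (@eq_cexpectation _ _ _ P _ (fun=> (1 : R)%:C)); last first.
  by move=> w; rewrite mul0r cis0.
rewrite cexpectation_real Rintegral_cst// mul1r; congr (_%:C).
by transitivity (fine (1%:E : \bar R)) => //; congr fine; exact: probability_setT.
Qed.

Lemma charfunN t : charfun X (- t) = conjc (charfun X t).
Proof.
rewrite /charfun /cexpectation/=; congr (_ +i* _).
  by apply: eq_Rintegral => w _; rewrite mulNr cosN.
rewrite -mulN1r -RintegralZl//; last exact/bmeas_integrable/bmeas_sin.
by apply: eq_Rintegral => w _; rewrite mulNr sinN mulN1r.
Qed.

Lemma continuous_integral_phase (f : R -> R) : continuous f ->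
  (forall x : R, `|f x| <= 1) -> continuous (fun t : R => \int[P]_w f (t * X w)).
Proof.
move=> cf f1 t; apply/(@cvg_nbhsP _ R^o) => u ut.
apply: (@bounded_cvg_Rintegral _ _ _ P _ _ 1) => //.
  move=> n; apply: measurableT_comp => //; exact: continuous_measurable_fun.
move=> w; apply: (@cvg_comp _ _ _ (fun n => u n * X w) f _ (nbhs (t * X w)));
  last exact: cf.
by apply: cvgM => //; exact: cvg_cst.
Qed.

Lemma continuous_Re_charfun : continuous (fun t => Re (charfun X t)).
Proof. by apply: continuous_integral_phase; [exact: continuous_cos | exact: cos_max]. Qed.

Lemma continuous_Im_charfun : continuous (fun t => Im (charfun X t)).
Proof. by apply: continuous_integral_phase; [exact: continuous_sin | exact: sin_max]. Qed.

Lemma charfun_le1 t : Re (charfun X t) <= 1.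
Proof.
have -> : 1 = \int[P]_w 1 :> R.
  by have /(congr1 Re) := charfun0; rewrite /charfun/cexpectation/=;
    under eq_Rintegral do rewrite mul0r cos0.
apply: le_Rintegral => //; [exact/bmeas_integrable/bmeas_cos | exact/bmeas_integrable/bmeas_cst |].
by move=> w _; exact: cos_le1.
Qed.

End CharacteristicFunction.

(** * Linear structural causal models *)

Section ScmCharacteristic.
Context (R : realType) (n : nat).
Implicit Types (B : 'M[R]_n) (r s : 'rV[R]_n).

Definition linear_form r (x : n.-tuple R) : R := \sum_i r 0 i * tnth x i.

Lemma linear_formE r x : linear_form r x = (r *m col_of_tuple x) 0 0.
Proof. by rewrite mxE; apply: eq_bigr => i _; rewrite mxE. Qed.

Lemma measurable_linear_form r : measurable_fun setT (linear_form r).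
Proof.
apply: measurable_sum => i; apply: measurable_funM; first exact: measurable_cst.
exact: measurable_tnth.
Qed.

Section Model.
Context d (T : measurableType d) (P : probability T R).

Lemma cexpectation_ae (f g : T -> R) :
  measurable_fun setT f -> measurable_fun setT g -> {ae P, forall w, f w = g w} ->
  cexpectation P (fun w => cis (f w)) = cexpectation P (fun w => cis (g w)).
Proof.
move=> mf mg fg; rewrite /cexpectation; congr (_ +i* _); congr fine.
  apply: ae_eq_integral => //.
  - by apply/measurable_EFinP; case: (bmeas_cos mf).
  - by apply/measurable_EFinP; case: (bmeas_cos mg).
  - by apply: filterS fg => w fgw _ /=; rewrite fgw.
apply: ae_eq_integral => //.
- by apply/measurable_EFinP; case: (bmeas_sin mf).
- by apply/measurable_EFinP; case: (bmeas_sin mg).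
- by apply: filterS fg => w fgw _ /=; rewrite fgw.
Qed.

(** Almost surely (I - B) X is the noise vector, so the linear form is the sum of the s_i eps_i, and
    independence splits its characteristic function. *)
Lemma scm_charfun B (eps : 'I_n -> {RV P >-> R}) (X : {RV P >-> n.-tuple R}) s :
  linear_scm P B eps X ->
  cexpectation P (fun w => cis (linear_form (s *m (1%:M - B)) (X w))) =
  \prod_i charfun (eps i) (s 0 i).
Proof.
move=> [_ eqs ind _].
have mX : measurable_fun setT X by exact: measurable_funP.
have meps i : measurable_fun setT (eps i) by exact: measurable_funP.
rewrite (@cexpectation_ae _ (fun w => \sum_i s 0 i * eps i w)).
- rewrite -(@cexpectation_prod _ _ _ P _ eps (fun i (x : measurableTypeR R) => cis (s 0 i * x)))//.
    apply: eq_cexpectation => w; elim/big_ind2 : _ => [|x1 x2 y1 y2 <- <-|//].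
      by rewrite cis0.
    by rewrite cisD.
  by move=> i; apply: cbmeas_cis; apply: measurable_funM => //; exact: measurable_cst.
- exact: (measurableT_comp (measurable_linear_form _) mX).
- by apply: measurable_sum => i; apply: measurable_funM => //; exact: measurable_cst.
- apply: filterS eqs => w Xw; rewrite linear_formE -mulmxA mulmxBl mul1mx {1}Xw.
  rewrite addrAC subrr add0r mxE.
  by apply: eq_bigr => i _; rewrite mxE.
Qed.

End Model.

Lemma same_distribution_phase d1 (T1 : measurableType d1) (P1 : probability T1 R)
    (X1 : {RV P1 >-> n.-tuple R}) d2 (T2 : measurableType d2) (P2 : probability T2 R)
    (X2 : {RV P2 >-> n.-tuple R}) r :
  same_distribution P1 X1 P2 X2 ->
  cexpectation P1 (fun w => cis (linear_form r (X1 w))) =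
  cexpectation P2 (fun w => cis (linear_form r (X2 w))).
Proof.
move=> same.
have push d (T : measurableType d) (P : probability T R) (X : {RV P >-> n.-tuple R}) (f : n.-tuple R -> R) :
    bmeas f -> \int[P]_w f (X w) = \int[distribution P X]_x f x.
  move=> bf; have mX : measurable_fun setT X by exact: measurable_funP.
  congr fine; rewrite integral_distribution//.
    by apply/measurable_EFinP; case: bf.
  apply: bmeas_integrable; have [mf [M fM]] := bf.
  by split; [exact: (measurableT_comp mf mX) | exists M].
have E (f : n.-tuple R -> R) : bmeas f -> \int[P1]_w f (X1 w) = \int[P2]_w f (X2 w).
  move=> bf; rewrite !push//; congr fine; apply: eq_measure_integral => A mA _.
  exact: same.
rewrite /cexpectation; congr (_ +i* _).
  by apply: (E (fun x => cos (linear_form r x))); apply: bmeas_cos;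
    exact: measurable_linear_form.
by apply: (E (fun x => sin (linear_form r x))); apply: bmeas_sin;
  exact: measurable_linear_form.
Qed.

End ScmCharacteristic.

(** * Recognising Gaussian noise from its characteristic function *)

Section GaussianNoise.
Context d (T : measurableType d) (R : realType) (P : probability T R).
Variable X : {RV P >-> R}.
Hypothesis ncX : nonconstant P X.

Let mX : measurable_fun setT X. Proof. exact: measurable_funP. Qed.

(* [R] and [measurableTypeR R] have the same measurable sets but different
   displays. *)
Let X' : T -> measurableTypeR R := X.

Let mX' : measurable_fun setT X'. Proof. exact: mX. Qed.

HB.instance Definition _ := @isMeasurableFun.Build _ _ _ _ X' mX'.

Let law : probability (measurableTypeR R) R := distribution P X'.

Let law_push (f : measurableTypeR R -> R) :
  bmeas f -> \int[law]_x f x = \int[P]_w f (X w).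
Proof.
move=> bf; have [mf [M fM]] := bf.
congr fine; rewrite integral_distribution//; first exact/measurable_EFinP.
by apply: bmeas_integrable; split; [exact: (measurableT_comp mf mX) | exists M].
Qed.

Lemma distribution_of_charfun (nu : probability (measurableTypeR R) R) :
  (forall t, charfun X t = (\int[nu]_x cos (t * x)) +i* (\int[nu]_x sin (t * x))) ->
  forall A : set (measurableTypeR R), measurable A -> distribution P X A = nu A.
Proof.
have mt t : measurable_fun setT (fun x : measurableTypeR R => t * x).
  by apply: measurable_funM => //; exact: measurable_cst.
move=> E A mA; apply: (@characteristic_function_unique _ law nu) => // t.
  by rewrite law_push; [case: (E t) | exact: bmeas_cos].
by rewrite law_push; [case: (E t) | exact: bmeas_sin].
Qed.

(** If s < 0, the real part exceeds 1 at a nonzero t with cos (m t) = 1. If s = 0, the law is the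
    Dirac mass at m, which [ncX] excludes. Otherwise the law is normal with deviation sqrt (2 s). *)
Lemma gaussian_of_charfun m s :
  (forall t, charfun X t = (expR (- (s * t ^+ 2)))%:C * cis (m * t)) ->
  0 < s /\ gaussian P X.
Proof.
move=> E.
have Er t : charfun X t = (expR (- (s * t ^+ 2)) * cos (m * t)) +i* (expR (- (s * t ^+ 2)) * sin (m * t)).
  by rewrite E; simpc.
have sq0 : 0 <= s.
  rewrite leNgt; apply/negP => sn.
  have [t t0 ct] : exists2 t, t != 0 & cos (m * t) = 1.
    have [->|m0] := eqVneq m 0; first by exists 1; rewrite ?oner_neq0// mul0r cos0.
    exists (pi *+ 2 / m); first by rewrite mulf_neq0 ?invr_neq0// mulrn_eq0/= gt_eqF// pi_gt0.
    by rewrite mulrC divfK// cos2pi.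
  have := charfun_le1 X t; rewrite Er/= ct mulr1 leNgt => /negP; apply.
  by rewrite -expR0 ltr_expR oppr_gt0 pmulr_llt0// exprn_even_gt0.
have s0 : 0 < s.
  rewrite lt_neqAle sq0 andbT eq_sym; apply/eqP => s0.
  pose delta : probability (measurableTypeR R) R := dirac (m : measurableTypeR R).
  have law_dirac (A : set (measurableTypeR R)) : measurable A -> distribution P X A = delta A.
    apply: distribution_of_charfun => t; rewrite Er s0 mul0r oppr0 expR0 !mul1r.
    have mt : measurable_fun setT (fun x : measurableTypeR R => t * x).
      by apply: measurable_funM => //; exact: measurable_cst.
    rewrite /Rintegral !integral_dirac//.
    - by rewrite !diracT !mul1e/= ![t * _]mulrC.
    - by apply/measurable_EFinP; case: (bmeas_sin mt).
    - by apply/measurable_EFinP; case: (bmeas_cos mt).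
  apply: (ncX (c := m)); exists (X @^-1` (~` [set m])); split => //.
    by apply: measurable_funPTI; apply: measurableC; exact: measurable_set1.
  have mC : measurable (~` [set m] : set (measurableTypeR R)).
    by apply: measurableC; exact: measurable_set1.
  by apply: (etrans (law_dirac _ mC)); rewrite [LHS]diracE memNset//=; apply.
split=> //; exists m, (Num.sqrt (2 * s)); split; first by rewrite sqrtr_gt0 mulr_gt0.
apply: distribution_of_charfun => t.
have sp : 0 < Num.sqrt (2 * s) by rewrite sqrtr_gt0 mulr_gt0.
rewrite normal_prob_cos// normal_prob_sin// Er sqr_sqrtr ?mulr_ge0//.
by have -> : 2 * s / 2 = s by field.
Qed.

End GaussianNoise.

(** * Separation of the noise terms *)

Section Separation.
Context (R : realType) (n : nat).
Implicit Types (t : 'rV[R]_n) (i j k : 'I_n).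
Variables (f g : 'I_n -> R -> R[i]) (M : 'M[R]_n).
Hypothesis uM : M \in unitmx.
Hypothesis f0 : forall j, f j 0 = 1.
Hypothesis fM : forall t, \prod_j f j ((t *m M) 0 j) = \prod_i g i (t 0 i).

Lemma rectangle_identity i k j u x y : i != k ->
  f j u * f j (u + x * M i j + y * M k j) *
    \prod_(l | l != j) f l (x * M i l + y * M k l) =
  f j (u + x * M i j) * f j (u + y * M k j) *
    \prod_(l | l != j) (f l (x * M i l) * f l (y * M k l)).
Proof.
move=> ik.
pose e (m : 'I_n) : 'rV[R]_n := delta_mx 0 m.
(* [t0 *m M] is u times the j-th unit row, so u enters the argument of [f j] only. *)
pose t0 := u *: (e j *m invmx M).
pose F t := \prod_l f l ((t *m M) 0 l).
have FE x' y' : F (t0 + x' *: e i + y' *: e k) = f j (u + x' * M i j + y' * M k j) *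
    \prod_(l | l != j) f l (x' * M i l + y' * M k l).
  have cE l : ((t0 + x' *: e i + y' *: e k) *m M) 0 l =
      u *+ (l == j) + x' * M i l + y' * M k l.
    rewrite !mulmxDl -!scalemxAl -mulmxA mulVmx// mulmx1 -!rowE !mxE eqxx/= eq_sym.
    by rewrite mulr_natr.
  rewrite /F (bigD1 j)//= cE eqxx mulr1n; congr (_ * _).
  by apply: eq_bigr => l /negbTE lj; rewrite cE lj mulr0n add0r.
have rect : F (t0 + 0 *: e i + 0 *: e k) * F (t0 + x *: e i + y *: e k) =
    F (t0 + x *: e i + 0 *: e k) * F (t0 + 0 *: e i + y *: e k).
  rewrite /F !fM -!big_split/=; apply: eq_bigr => l _.
  rewrite !mxE eqxx/= !mul0r !addr0.
  have [->|li] := eqVneq l i; first by rewrite (negbTE ik) !mulr0 !addr0 mulrC.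
  by rewrite !mulr0 !addr0.
move: rect; rewrite !FE !mul0r !addr0.
under eq_bigr do rewrite !mul0r addr0 f0.
rewrite big1// mulr1 big_split/=.
under [in RHS]eq_bigr do rewrite mul0r addr0.
under [X in _ = _ * (_ * X)]eq_bigr do rewrite mul0r add0r.
by move=> E; rewrite -mulrA E; ring.
Qed.

Hypothesis fN : forall j x, f j (- x) = conjc (f j x).
Hypothesis fRe : forall j, continuous (fun x => Re (f j x)).
Hypothesis fIm : forall j, continuous (fun x => Im (f j x)).

Lemma nonzero_near0 : exists2 e : R, 0 < e & forall l x, `|x| < e -> f l x != 0.
Proof.
have /choice[e eP] : forall l, exists e : R, 0 < e /\ forall x, `|x| < e -> f l x != 0.
  move=> l; have := @fRe l 0; move/cvgrPdist_lt => /(_ 1 ltr01)/nbhs_ballP[e /= e0 H].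
  exists e; split=> // x xe; have := H x; rewrite /ball/= sub0r normrN => /(_ xe).
  by rewrite f0/=; apply: contraTneq => ->; rewrite /= subr0 normr1 ltxx.
have e0 l : 0 < e l by case: (eP l).
have S0 : 0 < 1 + \sum_l (e l)^-1 by rewrite ltr_wpDr// sumr_ge0// => l _;
  rewrite invr_ge0 ltW.
(* A radius below every [e l]; the summand 1 keeps it positive even when the sum is empty. *)
exists (1 + \sum_l (e l)^-1)^-1; first by rewrite invr_gt0.
move=> l x xe; case: (eP l) => _; apply; apply: (lt_le_trans xe).
rewrite -[leRHS]invrK lef_pV2 ?posrE ?invr_gt0//.
rewrite (bigD1 l)//= addrCA lerDl addr_ge0// sumr_ge0// => k _.
by rewrite invr_ge0 ltW.
Qed.

Lemma quadratic_of_two_entries i k j : i != k -> M i j != 0 -> M k j != 0 ->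
  exists m s, forall x, f j x = (expR (- (s * x ^+ 2)))%:C * cis (m * x).
Proof.
move=> ik Mij Mkj; have [e e0 enz] := nonzero_near0.
(* [C] bounds all ratios to the entries in column j. Increments below e / 2 / C thus move the
   arguments of the other factors by less than e in total, where no [f l] vanishes. *)
pose C := 1 + \sum_l (`|M i l / M i j| + `|M k l / M k j|).
have C1 : 1 <= C by rewrite lerDl sumr_ge0// => l _; rewrite addr_ge0.
have C0 : 0 < C by lra.
have MC l : `|M i l / M i j| <= C /\ `|M k l / M k j| <= C.
  have : `|M i l / M i j| + `|M k l / M k j| <= C.
    by rewrite /C (bigD1 l)//= addrCA lerDl addr_ge0// sumr_ge0.
  by have := normr_ge0 (M i l / M i j); have := normr_ge0 (M k l / M k j); lra.
have d0 : 0 < e / 2 / C by rewrite !divr_gt0.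
apply: (quadratic_functional_equation d0) => // a b ae be.
have small z w : `|z| < e / 2 / C -> `|w| <= C -> `|z * w| < e / 2.
  move=> ze wC; rewrite normrM; apply: (@le_lt_trans _ _ (`|z| * C)).
    by rewrite ler_wpM2l.
  by rewrite -ltr_pdivlMr.
pose x := a / M i j; pose y := b / M k j.
have xl l : `|x * M i l| < e / 2.
  by rewrite /x mulrAC -mulrA; apply: small => //; case: (MC l).
have yl l : `|y * M k l| < e / 2.
  by rewrite /y mulrAC -mulrA; apply: small => //; case: (MC l).
pose K1 := \prod_(l | l != j) f l (x * M i l + y * M k l).
pose K2 := \prod_(l | l != j) (f l (x * M i l) * f l (y * M k l)).
have K1n : K1 != 0.
  apply/prodf_neq0 => l _; apply: enz.
  by apply: (le_lt_trans (ler_normD _ _)); have := xl l; have := yl l; lra.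
have K2n : K2 != 0.
  apply/prodf_neq0 => l _; rewrite mulf_neq0//; apply: enz.
    by have := xl l; lra.
  by have := yl l; lra.
(* [K1] and [K2] involve only the columns other than j, hence not u. *)
exists (K2 / K1); first by rewrite mulf_neq0 ?invr_neq0.
move=> u; have := rectangle_identity j u x y ik.
rewrite -/K1 -/K2 /x /y !divfK// => E.
by apply: (mulIf K1n); rewrite E; field.
Qed.

(** Row r contributes nothing outside column j, so the other factors cancel and [f j] is
    multiplicative at a = M r j and b = y * M k j; comparing moduli gives s * a * b = 0. Only y has
    to be small, since the cancelled factors depend on y alone. *)
Lemma not_isolated_row r k j m s : r != k -> 0 < s ->
  (forall x, f j x = (expR (- (s * x ^+ 2)))%:C * cis (m * x)) ->
  (forall l, l != j -> M r l = 0) -> M r j != 0 -> M k j = 0.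
Proof.
move=> rk s0 fE Mr0 Mrj; apply/eqP/negPn/negP => Mkj.
have [e e0 enz] := nonzero_near0.
pose C := 1 + \sum_l `|M k l|.
have C0 : 0 < C by rewrite ltr_wpDr// sumr_ge0.
have MC l : `|M k l| <= C.
  by rewrite /C (bigD1 l)//= addrCA lerDl addr_ge0// sumr_ge0.
pose y := e / 2 / C.
have y0 : 0 < y by rewrite !divr_gt0.
have yl l : `|y * M k l| < e.
  rewrite normrM gtr0_norm//; apply: (@le_lt_trans _ _ (y * C)).
    by rewrite ler_wpM2l// ltW.
  by rewrite /y divfK ?gt_eqF//; lra.
have := rectangle_identity j 0 1 y rk; rewrite f0 !add0r !mul1r.
have -> : \prod_(l | l != j) f l (1 * M r l + y * M k l) = \prod_(l | l != j) f l (y * M k l).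
  by apply: eq_bigr => l lj; rewrite Mr0// mulr0 add0r.
have -> : \prod_(l | l != j) (f l (1 * M r l) * f l (y * M k l)) = \prod_(l | l != j) f l (y * M k l).
  by apply: eq_bigr => l lj; rewrite Mr0// mulr0 f0 mul1r.
have Kn : \prod_(l | l != j) f l (y * M k l) != 0 by apply/prodf_neq0 => l _; exact: enz.
move=> /(mulIf Kn) /(congr1 sqrc); rewrite !fE !sqrcM !sqrc_cis !sqrc_real !mulr1.
rewrite -!expRM_natl -expRD => /expR_inj.
set a := M r j; set b := y * M k j => H.
have : s * (a * b) = 0 by move: H; rewrite ?mulr_natl; nra.
apply/eqP; apply: mulf_neq0; first by rewrite gt_eqF.
by apply: mulf_neq0 => //; apply: mulf_neq0 => //; rewrite gt_eqF.
Qed.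

End Separation.

(** * Condensations *)

Section CondensationOfPermutedRows.
Context {V : finType}.
Implicit Type e : rel V.

(** The closed in-neighbourhood of i, which models the nonzero pattern of row i of I - B. *)
Definition support e : rel V := fun i x => (x == i) || e x i.

Lemma mutually_reachable_trans e : transitive (mutually_reachable e).
Proof.
move=> y x z /andP[xy yx] /andP[yz zy]; apply/andP.
by split; [exact: connect_trans xy yz | exact: connect_trans zy yx].
Qed.

Lemma mutually_reachable_sym e x y : mutually_reachable e x y = mutually_reachable e y x.
Proof. by rewrite /mutually_reachable/= andbC. Qed.

Section OneDirection.
Variables (e1 e2 : rel V) (s : V -> V).
Hypothesis s_inj : injective s.
Hypothesis supp : forall i x, support e2 i x = support e1 (s i) x.

(** Each x lies in its own support, hence in that of [s x], so x = s x or x -> s x is an edge. The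
    orbits of the injection s on a finite set are cycles, which gives the way back. *)
Lemma permuted_reachable i : mutually_reachable e1 i (s i).
Proof.
have step x : connect e1 x (s x).
  have := supp x x; rewrite {1}/support eqxx/= => /esym /orP[/eqP {1}->|].
    exact: connect0.
  exact: connect1.
apply/andP; split; first exact: step.
have : fconnect s (s i) i by rewrite fconnect_sym// fconnect1.
by apply: connect_sub => x y /eqP <-; exact: step.
Qed.

Lemma permuted_connect : subrel (connect e2) (connect e1).
Proof.
apply: connect_sub => x i xi.
have /andP[_ back] := permuted_reachable i.
have := supp i x; rewrite {1}/support xi orbT => /esym /orP[/eqP -> //|h].
exact: connect_trans (connect1 h) back.
Qed.

(** The head moves from v to [s v] inside its component; the alternative u = s v would put u in the
    component of v. *)
Lemma permuted_edge u v : ~~ mutually_reachable e1 u v -> e2 u v -> e1 u (s v).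
Proof.
move=> nuv uv; have := supp v u; rewrite {1}/support uv orbT => /esym /orP[/eqP us|//].
by move: nuv; rewrite mutually_reachable_sym us permuted_reachable.
Qed.

End OneDirection.

Lemma mem_scc e (S : {set V}) x y :
  S \in sccs e -> x \in S -> (y \in S) = mutually_reachable e x y.
Proof.
move=> /imsetP[z _ ->]; rewrite !inE/= => zx.
apply/idP/idP => [zy|xy].
  by apply: (mutually_reachable_trans (y := z)) => //; rewrite mutually_reachable_sym.
exact: mutually_reachable_trans zx xy.
Qed.

Lemma condensation_permuted_rows e1 e2 (s1 s2 : V -> V) :
  injective s1 -> injective s2 ->
  (forall i x, support e2 i x = support e1 (s1 i) x) ->
  (forall i x, support e1 i x = support e2 (s2 i) x) ->
  condensation e1 = condensation e2.
Proof.
move=> i1 i2 H1 H2.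
have cE : connect e1 =2 connect e2.
  by move=> x y; apply/idP/idP; [exact: (permuted_connect i2 H2) | exact: (permuted_connect i1 H1)].
have mE : mutually_reachable e1 = mutually_reachable e2.
  by apply/funext => x; apply/funext => y; rewrite /mutually_reachable/= !cE.
have sE : sccs e1 = sccs e2 by rewrite /sccs mE.
rewrite /condensation sE; congr (_, _).
apply/setP => -[S S']; rewrite !inE/= sE.
case SV : (S \in sccs e2) => //; case S'V : (S' \in sccs e2) => //=.
case: (altP (S =P S')) => //= SS'.
have nm u v : u \in S -> v \in S' -> ~~ mutually_reachable e2 u v.
  move=> uS vS'; apply: contra SS' => uv; apply/eqP/setP => x.
  by rewrite (mem_scc x SV uS) -(mem_scc x S'V _)// (mem_scc u S'V vS') mutually_reachable_sym.
apply/exists_inP/exists_inP => -[u uS /exists_inP[v vS' uv]]; exists u => //;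
  apply/exists_inP.
  exists (s2 v); first by rewrite (mem_scc _ S'V vS') (permuted_reachable i2 H2).
  by apply: (permuted_edge i2 H2) => //; exact: nm.
exists (s1 v); first by rewrite (mem_scc _ S'V vS') -mE (permuted_reachable i1 H1).
by apply: (permuted_edge i1 H1) => //; rewrite mE; exact: nm.
Qed.

End CondensationOfPermutedRows.

(** * Identifiability of the condensation *)

Section MonomialMatrix.
Context (F : fieldType) (n : nat).
Implicit Types (A M : 'M[F]_n) (i j k l : 'I_n).

Lemma unitmx_row_neq0 M i : M \in unitmx -> exists l, M i l != 0.
Proof.
move=> uM; apply/existsP; apply: contraT => /existsPn M0.
have : delta_mx 0 i *m M = 0 :> 'rV[F]_n.
  rewrite -rowE; apply/rowP => l; rewrite !mxE.
  by apply/eqP; have := M0 l; rewrite negbK.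
move=> /(congr1 (mulmx^~ (invmx M))); rewrite mulmxK// mul0mx => /rowP /(_ i).
by rewrite !mxE !eqxx => /eqP; rewrite oner_eq0.
Qed.

(** Choosing a nonzero entry in each row is injective by the column condition, hence bijective.
    Every column is then used up by one row, so row i of M has the single nonzero entry [s i]. *)
Lemma permuted_rows A M : M \in unitmx ->
  (forall j i k, M i j != 0 -> M k j != 0 -> i = k) ->
  exists2 s : 'I_n -> 'I_n, injective s &
    forall i x, ((M *m A) i x != 0) = (A (s i) x != 0).
Proof.
move=> uM col; have /choice[s sP] := fun i => unitmx_row_neq0 i uM.
have s_inj : injective s by move=> i k sik; apply: (col (s i)); rewrite // sik.
exists s => // i x; rewrite mxE (bigD1 (s i))//= big1 ?addr0.
  by rewrite mulf_eq0 negb_or sP.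
move=> l ls; have [g sg gs] := injF_bij s_inj.
have [->|Mil] := eqVneq (M i l) 0; first by rewrite mul0r.
have il : i = g l by apply: (col l) => //; rewrite -{2}(gs l).
by move: ls; rewrite il gs eqxx.
Qed.

(** Otherwise each row has a nonzero entry outside column j, and these lie in distinct columns: an
    injection of the finite index set into itself that misses j. *)
Lemma isolated_row M j : M \in unitmx ->
  (forall l i k, l != j -> M i l != 0 -> M k l != 0 -> i = k) ->
  exists r, forall l, l != j -> M r l = 0.
Proof.
move=> uM col; apply: contrapT => /forallNP H.
have /choice[s sP] : forall r, exists l, l != j /\ M r l != 0.
  move=> r; have /existsNP[l /not_implyP[lj /eqP Ml]] := H r.
  by exists l.
have s_inj : injective s.
  move=> i k sik; have [si Mi] := sP i; have [_ Mk] := sP k.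
  by apply: (col (s i)) => //; rewrite sik.
have [g sg gs] := injF_bij s_inj.
by have [] := sP (g j); rewrite gs eqxx.
Qed.

End MonomialMatrix.

(** A self-loop of weight 1 would cancel the diagonal entry of I - B, whereas [support] always
    contains the diagonal. *)
Lemma support_graph_of (R : realType) (n : nat) (B : 'M[R]_n) i x :
  B i i != 1 -> support (graph_of B) i x = ((1%:M - B) i x != 0).
Proof.
move=> loop; rewrite /support /graph_of !mxE [x == i]eq_sym.
have [<-|ix] /= := eqVneq i x; first by rewrite subr_eq0 eq_sym loop.
by rewrite sub0r oppr_eq0.
Qed.

Theorem theorem1 (R : realType) (d : nat) (B1 B2 : 'M[R]_d)
  (d1 : measure_display) (O1 : measurableType d1) (P1 : probability O1 R)
  (d2 : measure_display) (O2 : measurableType d2) (P2 : probability O2 R)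
  (eps1 : 'I_d -> {RV P1 >-> R}) (X1 : {RV P1 >-> d.-tuple R})
  (eps2 : 'I_d -> {RV P2 >-> R}) (X2 : {RV P2 >-> d.-tuple R})
  (scm1 : linear_scm P1 B1 eps1 X1) (scm2 : linear_scm P2 B2 eps2 X2)
  (loop1 : forall i, B1 i i != 1) (loop2 : forall i, B2 i i != 1)
  (nondeg1 : forall i, nonconstant P1 (eps1 i))
  (nondeg2 : forall i, nonconstant P2 (eps2 i))
  (same_dist : same_distribution P1 X1 P2 X2) :
  condensation (graph_of B1) = condensation (graph_of B2).
Proof.
pose A1 := 1%:M - B1; pose A2 := 1%:M - B2.
have uA1 : A1 \in unitmx by rewrite unitmxE unitfE; case: scm1.
have uA2 : A2 \in unitmx by rewrite unitmxE unitfE; case: scm2.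
pose M := A2 *m invmx A1.
have uM : M \in unitmx by rewrite unitmx_mul uA2 unitmx_inv.
have MA : M *m A1 = A2 by rewrite /M mulmxKV.
pose f j := charfun (eps1 j); pose h i := charfun (eps2 i).
have fM (t : 'rV[R]_d) : \prod_j f j ((t *m M) 0 j) = \prod_i h i (t 0 i).
  apply: (etrans (esym (scm_charfun (t *m M) scm1))).
  apply: (etrans _ (scm_charfun t scm2)); rewrite -mulmxA -/A1 MA.
  exact: same_distribution_phase.
have f0 j : f j 0 = 1 by exact: charfun0.
have fN j x : f j (- x) = conjc (f j x) by exact: charfunN.
have fRe j : continuous (fun x => complex.Re (f j x)) by exact: continuous_Re_charfun.
have fIm j : continuous (fun x => complex.Im (f j x)) by exact: continuous_Im_charfun.
have gaussian_column i k j : i != k -> M i j != 0 -> M k j != 0 ->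
    gaussian P1 (eps1 j) /\ exists m s, 0 < s /\
      forall x, f j x = (expR (- (s * x ^+ 2)))%:C * cis (m * x).
  move=> ik Mij Mkj.
  have [m [s E]] := quadratic_of_two_entries uM f0 fM fN fRe fIm ik Mij Mkj.
  have [s0 gX] := gaussian_of_charfun (nondeg1 j) E.
  by split => //; exists m, s.
have column j i k : M i j != 0 -> M k j != 0 -> i = k.
  move=> Mij Mkj; apply/eqP/negPn/negP => ik.
  have [gj [m [s [s0 E]]]] := gaussian_column _ _ _ ik Mij Mkj.
  (* Another column with two nonzero entries would give a second Gaussian noise term, so only column
     j can have them. *)
  have [r Mr] : exists r, forall l, l != j -> M r l = 0.
    apply: isolated_row uM _ => l i' k' lj Mi Mk; apply/eqP/negPn/negP => ik'.
    have [gl _] := gaussian_column _ _ _ ik' Mi Mk.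
    by move: lj; rewrite (scm_one_gaussian scm1 gl gj) eqxx.
  have Mrj : M r j != 0.
    have [l Ml] := unitmx_row_neq0 r uM.
    by have [<-//|lj] := eqVneq l j; rewrite Mr ?eqxx in Ml.
  have iso k' : r != k' -> M k' j = 0.
    by move=> rk; exact: (not_isolated_row uM f0 fM fRe rk s0 E Mr Mrj).
  have [ri|ri] := eqVneq r i; last by move: Mij; rewrite iso ?eqxx.
  by move: Mkj; rewrite iso ?eqxx// ri.
have [s s_inj sE] := permuted_rows A1 uM column.
have [g sg gs] := injF_bij s_inj.
(* The inverse permutation [g] carries the row supports back from the second graph to the first. *)
apply: (condensation_permuted_rows s_inj (can_inj gs)) => i x.
  by rewrite !support_graph_of// -/A1 -/A2 -MA sE.
by rewrite !support_graph_of// -/A1 -/A2 -MA sE gs.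
Qed.
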